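(* Let $T$ be a tree with at least three vertices. Then the following properties are equivalent: (1) The domination subdivision number of $T$ equals $3$. (2) $T$ has a unique dominating $2$-packing containing all leaves of $T$. (3) $T$ belongs to the family $\mathcal{F}$ (with some labeling). (4) $T$ is (isomorphic to) a general corona $T'\circ\mathcal{P}$ of some tree $T'$. (5) There exists a tree $T'$ such that $T$ is obtained from the $2$-subdivision $S_2(T')$ by a sequence of internal contractions. (6) There exists a tree $T'$ such that $T$ is obtained from the corona $T'\circ K_1$ by a sequence of internal splittings.
   Context: Domination: a set $D$ is dominating if every vertex outside $D$ has a neighbor in $D$; $\gamma(G)$ is the minimum size of a dominating set. Subdividing an edge $uv$ replaces it by a path $u,x,v$ with a new vertex $x$. The domination subdivision number of a connected graph of order at least $3$ is the minimum number of edges that must be subdivided (each at most once) so that the domination number increases. A $2$-packing is a vertex set any two distinct members of which are at distance greater than $2$; a leaf is a vertex of degree $1$. The family $\mathcal{F}$ consists of trees whose vertices carry labels in $\{A,B\}$, defined as the smallest family that contains the path $P_4$ with its two leaves labeled $A$ and its two support vertices labeled $B$, and is closed under the operations: for a tree in $\mathcal{F}$ and a vertex $v$ of it, if $v$ has label $A$, attach a new path $x,y,z$ with labels $B,B,A$ by adding the edge $vx$; if $v$ has label $B$, attach a new path $x,y$ with labels $B,A$ by adding the edge $vx$. General corona: for a graph $T'$, a vertex neighborhood partition is a family $\mathcal{P}=\{\mathcal{P}(v): v\in V(T')\}$ where each $\mathcal{P}(v)$ is a partition of $N_{T'}(v)$ into nonempty parts; $T'\circ\mathcal{P}$ has vertex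 set $\{(v,1): v\in V(T')\}\cup\bigcup_{v}\{(v,A): A\in\mathcal{P}(v)\}$ and edge set $\bigcup_{v}\{(v,1)(v,A): A\in\mathcal{P}(v)\}\cup\bigcup_{uv\in E(T')}\{(v,A)(u,B): u\in A,\ v\in B\}$. Vertices $(v,1)$ are external; the vertices $(v,A)$ are internal. With $\mathcal{P}(v)=\{N_{T'}(v)\}$ for all $v$ one gets the corona $T'\circ K_1$ (one pendant vertex attached to each vertex of $T'$); with $\mathcal{P}(v)=\{\{u\}: u\in N_{T'}(v)\}$ for all $v$ one gets the $2$-subdivision $S_2(T')$ (each edge $uv$ replaced by a path $u,x_1,x_2,v$). An internal contraction of $T'\circ\mathcal{P}$ merges two internal vertices $(v,A),(v,B)$, $A\ne B\in\mathcal{P}(v)$, into one vertex adjacent to all neighbors of either, producing $T'\circ\mathcal{P}'$ with $\mathcal{P}'(v)=(\mathcal{P}(v)\setminus\{A,B\})\cup\{A\cup B\}$ and $\mathcal{P}'(x)=\mathcal{P}(x)$ for $x\neq v$; an internal splitting is the reverse operation. *)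

(* Defs.v *)
From mathcomp Require Import all_boot.
Set Implicit Arguments.
Unset Strict Implicit.
Unset Printing Implicit Defensive.

Record sgraph := SGraph {
  vertex :> finType;
  adj : rel vertex;
  adj_sym : symmetric adj;
  adj_irrefl : irreflexive adj
}.

Definition giso (G H : sgraph) : Prop :=
  exists2 f : G -> H, bijective f & {mono f : x y / adj x y}.

Definition nbhd (G : sgraph) (v : G) : {set G} := [set u | adj v u].

Definition edges (G : sgraph) : {set {set G}} :=
  [set [set x; y] | x in [set: G], y in nbhd x].

(* For [c] without repetitions, [cycle] also accepts the sequences [::] and
   [:: x; y] with [x] adjacent to [y]; genuine cycles have length at least 3. *)
Definition is_tree (G : sgraph) : Prop :=
  [/\ 0 < #|G|,
      forall x y : G, connect (@adj G) x y
    & forall c : seq G, ucycle (@adj G) c -> size c < 3].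

Definition leaf (G : sgraph) (v : G) : bool := #|nbhd v| == 1.

(* Every walk from [x] to [y] has more than [k] edges; this covers the case of
   infinite distance. *)
Definition dist_gt (G : sgraph) (k : nat) (x y : G) : Prop :=
  forall p : seq G, path (@adj G) x p -> last x p = y -> k < size p.

Definition two_packing (G : sgraph) (D : {set G}) : Prop :=
  forall x y : G, x \in D -> y \in D -> x != y -> dist_gt 2 x y.

Definition dominating (G : sgraph) (D : {set G}) : bool :=
  [forall v, (v \notin D) ==> [exists u in D, adj v u]].

Definition domination_number (G : sgraph) : nat :=
  #|[arg min_(D < [set: G] | dominating D) #|D|]|.

Section Subdivision.
Variables (G : sgraph) (F : {set {set G}}).

Definition subdivide_adj : rel (G + {e : {set G} | e \in F}) :=
  fun a b => match a, b with
  | inl u, inl v => adj u v && ([set u; v] \notin F)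
  | inl u, inr e => u \in val e
  | inr e, inl u => u \in val e
  | inr _, inr _ => false
  end.

Lemma subdivide_sym : symmetric subdivide_adj.
Proof. by move=> [u|e] [v|f] //=; rewrite adj_sym setUC. Qed.

Lemma subdivide_irrefl : irreflexive subdivide_adj.
Proof. by case=> [u|e] //=; rewrite adj_irrefl. Qed.

Definition subdivide := SGraph subdivide_sym subdivide_irrefl.
End Subdivision.

Definition sd_increasing (G : sgraph) (F : {set {set G}}) : bool :=
  (F \subset edges G) && (domination_number G < domination_number (subdivide F)).

(* The minimum is stated as an attained lower bound, so that no junk value
   arises for graphs in which no subdivision helps. *)
Definition sd_number_is (G : sgraph) (k : nat) : Prop :=
  (exists2 F : {set {set G}}, sd_increasing F & #|F| = k) /\
  (forall F : {set {set G}}, sd_increasing F -> k <= #|F|).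

Inductive label := LA | LB.

Record lgraph := LGraph { lgraph_graph :> sgraph; lab : lgraph_graph -> label }.

Definition liso (G H : lgraph) : Prop :=
  exists f : G -> H,
    [/\ bijective f, {mono f : x y / adj x y} & forall x, lab (f x) = lab x].

Definition path_adj n : rel 'I_n :=
  fun i j => (i.+1 == j :> nat) || (j.+1 == i :> nat).

Lemma path_adj_sym n : symmetric (@path_adj n).
Proof. by move=> i j; rewrite /path_adj orbC. Qed.

Lemma path_adj_irrefl n : irreflexive (@path_adj n).
Proof. by move=> i; rewrite /path_adj orbb gtn_eqF. Qed.

Definition path_graph n := SGraph (@path_adj_sym n) (@path_adj_irrefl n).

Definition labelled_path (s : seq label) : lgraph :=
  @LGraph (path_graph (size s)) (fun i => nth LA s i).

Section Attach.
Variables (G : lgraph) (v : G) (s : seq label).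

Definition attach_adj : rel (G + 'I_(size s)) :=
  fun a b => match a, b with
  | inl x, inl y => adj x y
  | inl x, inr i => (x == v) && (i == 0 :> nat)
  | inr i, inl x => (x == v) && (i == 0 :> nat)
  | inr i, inr j => path_adj i j
  end.

Lemma attach_sym : symmetric attach_adj.
Proof. by move=> [x|i] [y|j] //=; [apply: adj_sym | apply: path_adj_sym]. Qed.

Lemma attach_irrefl : irreflexive attach_adj.
Proof. by case=> [x|i] /=; [apply: adj_irrefl | apply: path_adj_irrefl]. Qed.

(* [v] is joined to the first vertex of a new path whose successive labels are
   listed by [s]. *)
Definition attach : lgraph :=
  @LGraph (SGraph attach_sym attach_irrefl)
    (fun a => match a with inl x => lab x | inr i => nth LA s i end).
End Attach.

Inductive family_F : lgraph -> Prop :=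
| F_P4 : family_F (labelled_path [:: LA; LB; LB; LA])
| F_A (G : lgraph) (v : G) :
    family_F G -> lab v = LA -> family_F (attach v [:: LB; LB; LA])
| F_B (G : lgraph) (v : G) :
    family_F G -> lab v = LB -> family_F (attach v [:: LB; LA])
| F_iso (G H : lgraph) : liso G H -> family_F G -> family_F H.

Definition nbhd_family (G : sgraph) := {ffun G -> {set {set G}}}.

Definition vertex_nbhd_partition (G : sgraph) (P : nbhd_family G) : bool :=
  [forall v, partition (P v) (nbhd v)].

Section Corona.
Variables (G : sgraph) (P : nbhd_family G).

(* [inl v] is the external vertex (v, 1) and [inr (v, A)] the internal vertex
   (v, A), where A \in P v. *)
Definition corona_adj : rel (G + {p : G * {set G} | p.2 \in P p.1}) :=
  fun a b => match a, b with
  | inl _, inl _ => false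
  | inl v, inr p => (val p).1 == v
  | inr p, inl v => (val p).1 == v
  | inr p, inr q =>
      [&& adj (val p).1 (val q).1, (val q).1 \in (val p).2
        & (val p).1 \in (val q).2]
  end.

Lemma corona_sym : symmetric corona_adj.
Proof. by move=> [u|p] [v|q] //=; rewrite adj_sym [X in _ && X]andbC. Qed.

Lemma corona_irrefl : irreflexive corona_adj.
Proof. by case=> [u|p] //=; rewrite adj_irrefl. Qed.

Definition general_corona := SGraph corona_sym corona_irrefl.
End Corona.

Definition coarsest_family (G : sgraph) : nbhd_family G :=
  [ffun v => [set nbhd v]].

Definition finest_family (G : sgraph) : nbhd_family G :=
  [ffun v => [set [set u] | u in nbhd v]].

Definition contract_family (G : sgraph) (P : nbhd_family G) (v : G)
    (A B : {set G}) : nbhd_family G :=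
  [ffun x => if x == v then (A :|: B) |: (P v :\: [set A; B]) else P x].

(* Internal contractions and splittings of [general_corona P] are recorded by
   their effect on [P]; [general_corona_contract] identifies
   [general_corona (contract_family P v A B)] with the graph in which the
   vertices (v, A) and (v, B) are merged. *)
Definition internal_contraction (G : sgraph) : rel (nbhd_family G) :=
  fun P P' => vertex_nbhd_partition P &&
    [exists v, exists A in P v, exists B in P v,
       (A != B) && (P' == contract_family P v A B)].

Definition internal_splitting (G : sgraph) : rel (nbhd_family G) :=
  fun P P' => internal_contraction P' P.

Section Merge.
Variables (G : sgraph) (a b : G).

(* [b] is removed and [a] takes over its neighbours. *)
Definition merge_adj : rel {x : G | x != b} :=
  fun x y => (x != y) &&
    [|| adj (val x) (val y), (val x == a) && adj b (val y)
      | (val y == a) && adj b (val x)].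

Lemma merge_sym : symmetric merge_adj.
Proof.
by move=> x y; rewrite /merge_adj eq_sym adj_sym [X in _ || X]orbC.
Qed.

Lemma merge_irrefl : irreflexive merge_adj.
Proof. by move=> x; rewrite /merge_adj eqxx. Qed.

Definition merge := SGraph merge_sym merge_irrefl.
End Merge.

Section TwoSubdivision.
Variable G : sgraph.

(* [inr (u, v)] is the new vertex next to [u] on the path replacing [uv]. *)
Definition S2_adj : rel (G + {p : G * G | adj p.1 p.2}) :=
  fun a b => match a, b with
  | inl _, inl _ => false
  | inl u, inr p => (val p).1 == u
  | inr p, inl u => (val p).1 == u
  | inr p, inr q => ((val p).1 == (val q).2) && ((val p).2 == (val q).1)
  end.

Lemma S2_sym : symmetric S2_adj.
Proof.
by move=> [u|p] [v|q] //=; rewrite andbC; congr andb; apply: eq_sym.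
Qed.

Lemma S2_irrefl : irreflexive S2_adj.
Proof.
case=> [u|[[u v] /= uv]] //=; apply/negP => /andP[/eqP e _].
by rewrite e adj_irrefl in uv.
Qed.

Definition two_subdivision := SGraph S2_sym S2_irrefl.
End TwoSubdivision.

Section CoronaK1.
Variable G : sgraph.

Definition corona_K1_adj : rel (G + G) :=
  fun a b => match a, b with
  | inl u, inl v => adj u v
  | inl u, inr v => u == v
  | inr u, inl v => u == v
  | inr _, inr _ => false
  end.

Lemma corona_K1_sym : symmetric corona_K1_adj.
Proof. by move=> [u|u] [v|v] //=; rewrite ?[LHS]eq_sym // adj_sym. Qed.

Lemma corona_K1_irrefl : irreflexive corona_K1_adj.
Proof. by case=> [u|u] //=; rewrite adj_irrefl. Qed.

Definition corona_K1 := SGraph corona_K1_sym corona_K1_irrefl.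
End CoronaK1.

Lemma general_corona_finest (G : sgraph) :
  giso (two_subdivision G) (general_corona (finest_family G)).
Proof.
have inP (p : {p : G * G | adj p.1 p.2}) :
    ((val p).1, [set (val p).2]).2
      \in finest_family G ((val p).1, [set (val p).2]).1.
  by case: p => [[u v] /= uv]; rewrite ffunE imset_f // inE.
pose f (a : two_subdivision G) : general_corona (finest_family G) :=
  match a with
  | inl u => inl u
  | inr p => inr (exist _ ((val p).1, [set (val p).2]) (inP p))
  end.
have outP (q : {p : G * {set G} | p.2 \in finest_family G p.1}) :
    {v | adj (val q).1 v & (val q).2 = [set v]}.
  case: q => [[u A] /= uA]; move: (uA); rewrite ffunE => /imsetP h.
  have /sigW[v /andP[uv /eqP->]] : exists v, adj u v && (A == [set v]).
    by case: h => v; rewrite inE => uv ->; exists v; rewrite uv eqxx.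
  by exists v.
pose g (a : general_corona (finest_family G)) : two_subdivision G :=
  match a with
  | inl u => inl u
  | inr q => let: exist2 v uv _ := outP q in
             inr (exist (fun p : G * G => adj p.1 p.2) ((val q).1, v) uv)
  end.
exists f.
  exists g.
    case=> [u|[[u v] uv]] //=; case: (outP _) => w uw /= /set1_inj e.
    by congr inr; apply: val_inj; rewrite /= e.
  case=> [u|q] //=; case: (outP _) => w uw /= e.
  by congr inr; apply: val_inj; rewrite /= -e; case: (val q).
case=> [u|[[u v] uv]] [u'|[[u' v'] uv']] //=; rewrite !in_set1.
rewrite eq_sym andbA [X in _ = X]andbC [v == _]eq_sym.
case: eqP => [->|_]; last by rewrite !andbF.
case: eqP => [e|_]; last by rewrite !andbF.
by rewrite e !andbT; move: uv => /=; rewrite e.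
Qed.

Lemma general_corona_coarsest (G : sgraph) :
  giso (corona_K1 G) (general_corona (coarsest_family G)).
Proof.
have inP (u : G) : (u, nbhd u).2 \in coarsest_family G (u, nbhd u).1.
  by rewrite ffunE /= set11.
pose f (a : corona_K1 G) : general_corona (coarsest_family G) :=
  match a with
  | inl u => inr (exist _ (u, nbhd u) (inP u))
  | inr u => inl u
  end.
pose g (a : general_corona (coarsest_family G)) : corona_K1 G :=
  match a with inl u => inr u | inr p => inl (val p).1 end.
exists f.
  exists g; first by case.
  case=> [u|[[u A] uA]] //=; congr inr; apply: val_inj => /=.
  by move: (uA); rewrite ffunE /= => /set1P->.
case=> [u|u] [v|v] //=.
by rewrite !inE [adj v u]adj_sym !andbb.
Qed.

Lemma general_corona_contract (G : sgraph) (P : nbhd_family G) (v : G)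
    (A B : {set G}) (Av : (v, A).2 \in P (v, A).1)
    (Bv : (v, B).2 \in P (v, B).1) :
  vertex_nbhd_partition P -> A != B ->
  giso (@merge (general_corona P) (inr (exist _ (v, A) Av))
          (inr (exist _ (v, B) Bv)))
       (general_corona (contract_family P v A B)).
Proof.
move=> /forallP/(_ v)/and3P[_ tP P0] AB.
set a : general_corona P := inr (exist _ (v, A) Av).
set b : general_corona P := inr (exist _ (v, B) Bv).
set P' := contract_family P v A B.
have ABnP : A :|: B \notin P v.
  apply/negP => ABP.
  have sub C : C \in P v -> C \subset A :|: B -> C = A :|: B.
    move=> CP /setIidPl CAB; apply: contraNeq P0 => nC.
    suff <- : C = set0 by [].
    by rewrite -CAB; apply/disjoint_setI0/(trivIsetP tP).
  by case/eqP: AB; rewrite (sub A) ?subsetUl // -(sub B) ?subsetUr.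
pose h (p : G * {set G}) := if p == (v, A) then (v, A :|: B) else p.
pose k (p : G * {set G}) := if p == (v, A :|: B) then (v, A) else p.
have h1 p : (h p).1 = p.1 by rewrite /h; case: eqP => [->|].
have hP (p : {p : G * {set G} | p.2 \in P p.1}) :
    (inr p : general_corona P) != b -> (h (val p)).2 \in P' (h (val p)).1.
  case: p => [[u C] /= uC] nb; rewrite h1 ffunE /h xpair_eqE /=.
  have [eu|nu] /= := eqVneq u v; last by [].
  subst u; case: eqP => [_|/eqP nA]; first by rewrite setU11.
  rewrite !inE uC negb_or nA !andbT orbC /=.
  apply/orP; left; apply: contraNneq nb => eC; apply/eqP; congr inr.
  by apply: val_inj; rewrite /= eC.
have kP (q : {p : G * {set G} | p.2 \in P' p.1}) :
    (k (val q)).2 \in P (k (val q)).1.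
  case: q => [[u C] /= uC]; rewrite /k xpair_eqE; move: uC; rewrite ffunE.
  have [->|nu] //= := eqVneq u v.
  by case: eqP => [_ _|/eqP nC] //=; rewrite !inE (negbTE nC) => /andP[].
have kb (q : {p : G * {set G} | p.2 \in P' p.1}) : k (val q) != (v, B).
  case: q => [[u C] /= uC]; rewrite /k xpair_eqE; move: uC; rewrite ffunE.
  have [->|nu] //= := eqVneq u v; last by rewrite xpair_eqE (negbTE nu).
  case: (C =P A :|: B) => [_ _|/eqP nC] /=; first by rewrite xpair_eqE eqxx.
  by rewrite !inE (negbTE nC) xpair_eqE eqxx negb_or => /andP[/andP[]].
have hk (q : {p : G * {set G} | p.2 \in P' p.1}) : h (k (val q)) = val q.
  case: q => [[u C] /= uC]; rewrite /k; case: eqP => [->|nAB].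
    by rewrite /h eqxx.
  rewrite /h; case: eqP => [[eu eC]|//]; subst u C; move: uC nAB.
  by rewrite ffunE eqxx !inE eqxx /= orbF => /eqP <-.
have kh (p : {p : G * {set G} | p.2 \in P p.1}) : k (h (val p)) = val p.
  case: p => [[u C] /= uC]; rewrite /h; case: eqP => [->|nA].
    by rewrite /k eqxx.
  by rewrite /k; case: eqP => // -[eu eC]; subst u C; rewrite uC in ABnP.
pose f (x : merge a b) : general_corona P' :=
  match val x as s return s != b -> general_corona P' with
  | inl u => fun=> inl u
  | inr p => fun pb => inr (exist _ (h (val p)) (hP p pb))
  end (valP x).
have gP (q : {p : G * {set G} | p.2 \in P' p.1}) :
    (inr (exist _ (k (val q)) (kP q)) : general_corona P) != b.
  by apply: contraNneq (kb q) => -[->].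
pose g (y : general_corona P') : merge a b :=
  match y with
  | inl u => exist (fun x => x != b) (inl u) isT
  | inr q => exist (fun x => x != b) (inr (exist _ (k (val q)) (kP q))) (gP q)
  end.
exists f.
  exists g.
    case=> [[u|p] pb]; apply: val_inj => //=.
    by congr inr; apply: val_inj; rewrite /= kh.
  by case=> [u|q] //=; congr inr; apply: val_inj; rewrite /= hk.
case=> [[u|p] xb] [[w|q] yb] //=; rewrite /merge_adj -val_eqE /= ?h1 ?orbF //.
- by rewrite andbF.
- rewrite -[inr q == a]/(sval q == (v, A)).
  by case: (sval q =P _) => [->|] /=; rewrite ?orbF ?orbb.
- rewrite -[inr p == a]/(sval p == (v, A)).
  by case: (sval p =P _) => [->|] /=; rewrite ?orbF ?orbb.
rewrite -[inr q == a]/(val q == (v, A)) -[inr p == a]/(val p == (v, A)).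
rewrite -[inr p == inr q]/(val p == val q) /h.
case: p xb => [[u C] /= _] _; case: q yb => [[w D] /= _] _.
have [[-> ->]|nC] := (u, C) =P (v, A); have [[-> ->]|nD] /= := (w, D) =P (v, A).
- by rewrite eqxx adj_irrefl.
- rewrite inE eq_sym (introF eqP nD) /=.
  by case: (adj v w); case: (w \in A); case: (w \in B); case: (v \in D).
- rewrite inE (introF eqP nC) /= [adj v u]adj_sym.
  by case: (adj u v); case: (u \in A); case: (u \in B); case: (v \in C).
- rewrite orbF; case: eqP => [[-> _]|_] //=.
  by rewrite adj_irrefl.
Qed.

(* Main.v *)
(** By the Meir-Moon theorem a tree T has a 2-packing S with |S| = gamma(T), and
    by weak duality a subdivision of T having a 2-packing of more than gamma(T)
    vertices has a larger domination number.  If no subdivision of at most two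
    edges helps, choose S with as many leaves as possible: a leaf z outside S
    could be exchanged for its support y if y were in S, and added after
    subdividing yz otherwise; and if u is not dominated by S, there is a path
    u, m, s with s in S, and the new vertex on um can be added to S after
    subdividing um and ms.  So S is a dominating 2-packing containing all leaves
    (a "leaf code").

    Conversely let D be a leaf code.  Subdividing the three edges of a path
    c, a, b, d with c, d in D allows adding the new vertex of ab to D.  For two
    edges e and f, take a path R having them as end edges and replace every
    vertex of D outside R by its neighbour towards R, and an end of R in D by
    the new vertex of the edge at that end: this dominates the subdivided tree.

    A leaf code corresponds to the external vertices of a general corona (T' is
    the quotient of T contracting each closed neighbourhood of a vertex of D)
    and to the A-labelled vertices of a member of F.  Internal contractions and
    splittings merely move between partitions. *)

Require Import Defs.
From mathcomp Require Import all_boot.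
From mathcomp Require Import zify.

Set Implicit Arguments.
Unset Strict Implicit.
Unset Printing Implicit Defensive.

(** * Packings and leaf codes *)

Section Domination.
Variable G : sgraph.
Implicit Types (D S : {set G}) (u v w x y : G).

Definition cnb w x := (w == x) || adj w x.

Definition packing S := forall x y w, x \in S -> y \in S -> cnb w x -> cnb w y -> x = y.

Lemma cnb_sym w x : cnb w x = cnb x w.
Proof. by rewrite /cnb eq_sym adj_sym. Qed.

Lemma adj_neq u v : adj u v -> u != v.
Proof. by move=> uv; apply: contraTneq uv => ->; rewrite adj_irrefl. Qed.

Lemma packingP S : two_packing S <-> packing S.
Proof.
split=> [tS x y w xS yS|pS x y xS yS xy].
  move=> wx wy; apply/eqP; apply: contraT => xy.
  have := tS _ _ xS yS xy; rewrite /dist_gt.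
  move: wx wy; rewrite /cnb => /orP[/eqP e|wx] /orP[/eqP e'|wy] dgt.
  - by rewrite -e -e' eqxx in xy.
  - by have := dgt [:: y]; rewrite /= -e wy => /(_ isT erefl).
  - by have := dgt [:: y]; rewrite /= -e' adj_sym wx => /(_ isT erefl).
  - by have := dgt [:: w; y]; rewrite /= adj_sym wx wy => /(_ isT erefl).
move=> [|a [|b [|//]]] /=; rewrite ?andbT => h e; apply: contraNT xy => _.
- by rewrite e.
- by rewrite -(pS x y y) // /cnb ?eqxx // adj_sym -e h orbT.
- have /andP[xa ab] := h.
  by rewrite -(pS x y a) // /cnb ?(adj_sym a x) ?xa -?e ?ab ?orbT.
Qed.

Lemma dominatingP D :
  reflect (forall v, v \notin D -> exists2 u, u \in D & adj v u) (dominating D).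
Proof.
apply: (iffP forallP) => [h v|h v].
  by move=> vD; have /implyP/(_ vD)/exists_inP := h v.
by apply/implyP => vD; apply/exists_inP; apply: h.
Qed.

Lemma dominating_cnb D v : dominating D -> exists2 u, u \in D & cnb v u.
Proof.
move=> /dominatingP dD; have [vD|/dD[u uD vu]] := boolP (v \in D).
  by exists v; rewrite // /cnb eqxx.
by exists u; rewrite // /cnb vu orbT.
Qed.

Lemma cnb_dominating D :
  (forall v, exists2 u, u \in D & cnb v u) -> dominating D.
Proof.
move=> h; apply/dominatingP => v vD; have [u uD /orP[/eqP e|vu]] := h v.
  by rewrite e uD in vD.
by exists u.
Qed.

Lemma domination_number_le D : dominating D -> domination_number G <= #|D|.
Proof.
rewrite /domination_number; case: arg_minnP => [|E _ h /h //].
by apply/dominatingP => v; rewrite inE.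
Qed.

Lemma domination_number_ex : exists2 D : {set G}, dominating D & #|D| = domination_number G.
Proof.
rewrite /domination_number; case: arg_minnP => [|E dE _]; last by exists E.
by apply/dominatingP => v; rewrite inE.
Qed.

Lemma packing_le_domination_number S : packing S -> #|S| <= domination_number G.
Proof.
move=> pS; have [D dD <-] := domination_number_ex.
have /fin_all_exists[f fP] x : exists u, u \in D /\ cnb x u.
  by have [u] := dominating_cnb x dD; exists u.
rewrite -(@card_in_imset _ _ f S) => [|x y xS yS e].
  by apply/subset_leq_card/subsetP => _ /imsetP[x _ ->]; have [] := fP x.
by apply: (pS _ _ (f x)) => //; rewrite cnb_sym; [|rewrite e]; case: (fP x) (fP y) => _ ? [].
Qed.

End Domination.

Section LeafCode.
Variable G : sgraph.
Implicit Types (D S : {set G}) (u v w x y : G).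

Record leaf_code D : Prop := LeafCode {
  code_indep : {in D &, forall x y, adj x y = false};
  code_inj : forall v x y, x \in D -> y \in D -> adj v x -> adj v y -> x = y;
  code_dom : forall v, v \notin D -> exists2 c, c \in D & adj v c;
  code_free : forall v, v \notin D -> exists2 b, b \notin D & adj v b }.

Lemma leafP v u w : leaf v -> adj v u -> adj v w -> u = w.
Proof.
move=> /cards1P[x e] vu vw; have uN : u \in nbhd v by rewrite inE.
have wN : w \in nbhd v by rewrite inE.
by move: uN wN; rewrite e !inE => /eqP -> /eqP.
Qed.

Lemma nonleaf v u : ~~ leaf v -> adj v u -> exists2 w, w != u & adj v w.
Proof.
move=> nl vu; have uN : u \in nbhd v by rewrite inE.
move: nl; rewrite /leaf (cardsD1 u) uN -(@eqn_add2l 1) /=.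
case: (set_0Vmem (nbhd v :\ u)) => [->|[w]]; first by rewrite cards0.
by rewrite !inE => /andP[wu vw] _; exists w.
Qed.

Lemma leaf_codeP D :
  [/\ dominating D, two_packing D & forall v, leaf v -> v \in D] <-> leaf_code D.
Proof.
split=> [[/dominatingP dD /packingP pD lD]|cD].
  split=> //.
  - move=> x y xD yD; apply/negP => xy.
    have := adj_neq xy; rewrite (pD x y x xD yD) ?eqxx // /cnb ?eqxx //.
    by rewrite xy orbT.
  - by move=> v x y xD yD vx vy; apply: (pD x y v); rewrite // /cnb ?vx ?vy orbT.
  - move=> v vD; have [c cD vc] := dD v vD.
    have [|b bc vb] := nonleaf _ vc; first by apply: contra vD; apply: lD.
    exists b => //; apply: contra bc => bD; apply/eqP.
    by apply: (pD b c v); rewrite // /cnb ?vb ?vc orbT.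
split.
- by apply/dominatingP => v /(code_dom cD).
- apply/packingP => x y w xD yD /orP[/eqP ->|wx] /orP[/eqP e|wy] //.
  + by rewrite (code_indep cD) in wy.
  + by rewrite -e in yD; rewrite (code_indep cD) in wx.
  + exact: (code_inj cD xD yD wx wy).
- move=> v lv; apply: contraT => vD.
  have [c cD' vc] := code_dom cD vD; have [b bD vb] := code_free cD vD.
  by rewrite -(leafP lv vc vb) cD' in bD.
Qed.

Lemma code_packing D : leaf_code D -> packing D.
Proof. by move=> /leaf_codeP[_ /packingP]. Qed.

Lemma code_dominating D : leaf_code D -> dominating D.
Proof. by move=> /leaf_codeP[]. Qed.

Lemma code_card D : leaf_code D -> #|D| = domination_number G.
Proof.
move=> cD; apply/eqP; rewrite eqn_leq packing_le_domination_number //.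
  exact/domination_number_le/code_dominating.
exact: code_packing.
Qed.

End LeafCode.

(** * Trees oriented towards a connected set *)

Section Trees.
Variable G : sgraph.
Implicit Types (R S : {set G}) (u v w x y : G).

Definition adj_in S := [rel x y : G | [&& x \in S, y \in S & adj x y]].

Definition connected_in S := {in S &, forall x y, connect (adj_in S) x y}.

Lemma adj_in_sym S : connect_sym (adj_in S).
Proof.
by apply: sym_connect_sym => x y /=; rewrite adj_sym andbCA.
Qed.

Lemma path_connected_in x s :
  path (@adj G) x s -> connected_in [set y in x :: s].
Proof.
move: [set y in x :: s] (fun y => in_set (mem (x :: s)) y) => S inS ps.
have h y : y \in x :: s -> connect (adj_in S) x y.
  have sS : {subset x :: s <= S} by move=> z; rewrite inS.
  elim: s x ps {inS} sS => [|a s IHs] x ps sS.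
    by rewrite inE => /eqP ->.
  move: ps => /= /andP[xa pa]; rewrite inE => /predU1P[->//|ys].
  apply: (@connect_trans _ _ a); last first.
    by apply: IHs ys => // z zs; apply: sS; rewrite inE zs orbT.
  by apply: connect1; rewrite /= xa !sS ?inE ?eqxx ?orbT.
move=> y z; rewrite !inS => /h xy /h xz.
by apply: connect_trans xz; rewrite adj_in_sym.
Qed.

Lemma connected_in_nbr S w u v : is_tree G ->
  connected_in S -> w \notin S -> u \in S -> v \in S -> adj w u -> adj w v -> u = v.
Proof.
move=> [_ _ acyc] cS wS uS vS wu wv.
have /connectP[p0 pp e0] := cS u v uS vS; move: e0.
case/shortenP: pp => p pp up _ e.
have pS : {subset p <= S}.
  elim: p u {uS wu up e} pp => //= a p IHp u /andP[/and3P[_ aS _] /IHp h] b.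
  by rewrite inE => /predU1P[->|/h].
have pa : path (@adj G) u p.
  by apply: sub_path pp => a b /= /and3P[].
have /acyc : ucycle (@adj G) (w :: u :: p).
  rewrite /ucycle /= rcons_path -e wu pa adj_sym wv /=.
  move: up => /= ->; rewrite andbT inE negb_or.
  rewrite (contraNneq _ wS) => [|->//]; apply: contra wS; exact: pS.
by case: p e {pp pS pa up} => //=.
Qed.

Lemma connected_in1 x : connected_in [set x].
Proof. by move=> a b /set1P -> /set1P ->. Qed.

Lemma connected_inU1 S w u : connected_in S -> u \in S -> adj w u ->
  connected_in (w |: S).
Proof.
move=> cS uS wu.
have h x : x \in w |: S -> connect (adj_in (w |: S)) u x.
  case/setU1P => [->|xS].
    by apply: connect1; rewrite /= !inE eqxx uS orbT adj_sym.
  apply: connect_sub (cS u x uS xS) => a b /= /and3P[aS bS ab].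
  by apply: connect1; rewrite /= !inE aS bS !orbT.
by move=> x y /h ux /h; apply: connect_trans; rewrite adj_in_sym.
Qed.

(* [p v] is the neighbour of [v] on the path from [v] to [R]; [h] is the
   distance to [R] up to an offset at each vertex of [R]. *)
Record towards R (p : G -> G) (h : G -> nat) : Prop := Towards {
  towards_adj : forall v, v \notin R -> adj v (p v);
  towards_depth : forall v, v \notin R -> h v = (h (p v)).+1;
  towards_edge : forall u v, adj u v ->
    [\/ u \in R /\ v \in R, u \notin R /\ p u = v | v \notin R /\ p v = u] }.

Lemma tree_towards R r : is_tree G -> connected_in R -> r \in R ->
  exists p h, towards R p h.
Proof.
move=> tG cR rR.
suff: forall n S, #|~: S| = n -> connected_in S -> R \subset S ->
  forall p h, (forall v, v \in S -> v \notin R -> adj v (p v) /\ p v \in S) ->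
   (forall v, v \in S -> v \notin R -> h v = (h (p v)).+1) ->
   (forall u v, u \in S -> v \in S -> adj u v ->
    [\/ u \in R /\ v \in R, u \notin R /\ p u = v | v \notin R /\ p v = u]) ->
   exists p h, towards R p h.
  move/(_ _ R erefl cR (subxx R) id (fun=> 0)); apply.
  - by move=> v ->.
  - by move=> v ->.
  - by move=> u v uR vR; constructor 1.
elim=> [|n IHn] S cS conS RS p h hp hh he.
  move/eqP: cS; rewrite cards_eq0 => /eqP cS.
  have inS x : x \in S by have := in_set0 x; rewrite -cS inE => /negbFE.
  exists p, h; split; [by move=> v /hp[]|by move=> v /hh->|by move=> u v; apply: he].
have [w [u [wS uS wu]]] : exists w u, [/\ w \notin S, u \in S & adj w u].
  case: (set_0Vmem (~: S)) => [e|[w wS]]; first by rewrite e cards0 in cS.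
  have [_ conG _] := tG.
  have [/existsP[a /existsP[b /and3P[]]]|none] :=
    boolP [exists a, exists b, [&& a \notin S, b \in S & adj a b]].
    by exists a, b.
  have clS : closed (@adj G) S.
    move=> a b ab; move/existsPn: none => none.
    have /existsPn/(_ a) := none b; have /existsPn/(_ b) := none a.
    by rewrite [adj b a]adj_sym ab !andbT; case: (a \in S); case: (b \in S).
  have := closed_connect clS (conG r w).
  by rewrite (subsetP RS) // inE in wS *; rewrite (negbTE wS).
have neq x : x \in S -> (x == w) = false.
  by move=> xS; apply: contraNF wS => /eqP <-.
have wR : w \notin R by apply: contra wS; apply: (subsetP RS).
pose p' x := if x == w then u else p x.
pose h' x := if x == w then (h u).+1 else h x.
apply: (IHn (w |: S) _ _ _ p' h').
- apply/eqP; rewrite -eqSS -cS (cardsD1 w (~: S)) inE wS add1n eqSS.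
  by apply/eqP/eq_card => x; rewrite !inE negb_or.
- exact: connected_inU1 wu.
- exact: subset_trans RS (subsetUr _ _).
- move=> v /setU1P[-> _|vS vR]; first by rewrite /p' eqxx inE uS orbT.
  by have [? pS] := hp v vS vR; rewrite /p' neq // inE pS orbT.
- move=> v /setU1P[-> _|vS vR]; rewrite /p' /h'; first by rewrite eqxx neq.
  by have [_ pS] := hp v vS vR; rewrite !neq // hh.
have hw a : a \in S -> adj w a -> u = a.
  move=> aS wa; exact: connected_in_nbr tG conS wS uS aS wu wa.
move=> a b /setU1P[->|aS] /setU1P[->|bS] ab; rewrite /p' ?eqxx ?neq //.
- by rewrite adj_irrefl in ab.
- by constructor 2; split=> //; apply: hw.
- by constructor 3; split=> //; apply: hw; rewrite // adj_sym.
- exact: he.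
Qed.

End Trees.


Lemma rooted_tree (G : sgraph) (r : G) (p : G -> G) (h : G -> nat) :
  (forall v, v != r -> adj v (p v)) -> (forall v, v != r -> h (p v) < h v) ->
  (forall u v, adj u v -> u != r /\ p u = v \/ v != r /\ p v = u) -> is_tree G.
Proof.
move=> pa ph pe; have cs : connect_sym (@adj G) by apply/sym_connect_sym/adj_sym.
split.
- by apply/card_gt0P; exists r.
- have cr x : connect (@adj G) r x.
    have [n] := ubnP (h x); elim: n x => // n IHn x hx.
    have [->//|xr] := eqVneq x r.
    apply: connect_trans (connect1 (_ : adj (p x) x)); last by rewrite adj_sym pa.
    by apply: IHn; apply: leq_trans (ph x xr) _.
  by move=> x y; apply: (@connect_trans _ _ r); rewrite // cs.
- move=> c uc; rewrite ltnNge; apply/negP => c3.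
  have [x0 x0c] : exists x0, x0 \in c.
    by case: c c3 {uc} => // a c _; exists a; rewrite inE eqxx.
  case: (@arg_maxnP _ x0 (mem c) h x0c) => x xc hmax.
  have [i s e] := rot_to xc.
  have: ucycle (@adj G) (x :: s) by rewrite -e rot_ucycle.
  have hm y : y \in x :: s -> h y <= h x by rewrite -e mem_rot => /hmax.
  have : 2 < size (x :: s) by rewrite -e size_rot.
  have hp y : y \in x :: s -> adj x y -> p x = y.
    move=> /hm hy /pe[[]//|[yr px]].
    by have := ph y yr; rewrite px ltnNge hy.
  case: s hp {e hm} => // y [|z s] // hp _ /andP[/= /and3P[xy yz pz] uq].
  have ey : p x = y by apply: hp; rewrite // !inE eqxx orbT.
  move: pz; rewrite rcons_path => /andP[_ lx].
  have el : p x = last z s.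
    by apply: hp; [rewrite 2!in_cons mem_last !orbT|rewrite adj_sym].
  by move: uq; rewrite -ey el mem_last /= andbF.
Qed.

Section Rooted.
Variables (G : sgraph) (r : G) (p : G -> G) (h : G -> nat).
Hypothesis ph : towards [set r] p h.

Lemma rooted_parent v : v != r -> adj v (p v) /\ h v = (h (p v)).+1.
Proof. by move=> vr; split; [apply: (towards_adj ph)|apply: (towards_depth ph)]; rewrite inE. Qed.

Lemma rooted_edge u v : adj u v ->
  [/\ u != r, p u = v & h u = (h v).+1] \/ [/\ v != r, p v = u & h v = (h u).+1].
Proof.
move=> uv; case: (towards_edge ph uv) => -[]; rewrite !inE.
- by move=> /eqP eu /eqP ev; move: uv; rewrite eu ev adj_irrefl.
- by move=> ur <-; left; have [] := rooted_parent ur.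
- by move=> vr <-; right; have [] := rooted_parent vr.
Qed.

(* Greedy choice: a deepest element [x] of [X] goes to the packing, and its
   parent, which covers everything of [X] within distance 2 of [x], to the cover. *)
Lemma tree_cover (X : {set G}) : exists D S : {set G},
  [/\ S \subset X, packing S, #|D| <= #|S|
    & {in X, forall x, exists2 u, u \in D & cnb x u}].
Proof.
elim: {X}#|X| {-2}X (leqnn #|X|) => [|n IHn] X.
  rewrite leqn0 cards_eq0 => /eqP ->; exists set0, set0.
  by split=> // x; rewrite inE.
have [->|[x0 x0X]] := set_0Vmem X.
  by move=> _; exists set0, set0; split=> // x; rewrite inE.
case: (@arg_maxnP _ x0 (mem X) h x0X) => x xX0 hmax leX.
have xX : x \in X by exact: xX0.
pose q := if x == r then x else p x.
have xq : cnb x q.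
  by rewrite /q /cnb; case: (eqVneq x r) => [_|/rooted_parent[->]]; rewrite ?eqxx ?orbT.
pose X' := [set y in X | ~~ cnb y q].
have [|D [S [SX' pS leD cov]]] := IHn X'.
  rewrite -ltnS; apply: leq_trans leX; apply: proper_card; apply/properP.
  split; first by apply/subsetP => y; rewrite inE => /andP[].
  by exists x => //; rewrite inE xX xq.
have sX y : y \in S -> y \in X /\ ~~ cnb y q.
  by move=> /(subsetP SX'); rewrite inE => /andP[].
have far y w : y \in S -> cnb w x -> cnb w y -> False.
  move=> yS wx wy; have [yX yq] := sX y yS; have hy : h y <= h x := hmax y yX.
  have nq a : cnb y a -> a <> q by move=> ya ea; rewrite -ea ya in yq.
  have {}nq a : cnb y a -> p x = a -> x <> r -> False.
    by move=> ya ea xr; apply: (nq a ya); rewrite /q (negbTE (introN eqP xr)).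
  have yx : y <> x by move=> e; rewrite e xq in yq.
  have yw : cnb y w by rewrite cnb_sym.
  have yy : cnb y y by rewrite /cnb eqxx.
  move: wx; rewrite cnb_sym => /orP[/eqP ew|/rooted_edge[[/eqP xr pw _]|[_ pw hw]]].
  - subst w; case/orP: wy => [/eqP/esym//|/rooted_edge[[/eqP xr px _]|[_ _]]].
      exact: (nq y).
    lia.
  - exact: (nq w).
  case/orP: wy => [/eqP e|/rooted_edge[[_ e _]|[_ _]]].
  - by rewrite -e in hy; lia.
  - by apply: yx; rewrite -pw.
  - lia.
have xS : x \notin S by apply/negP => /sX[_]; rewrite xq.
exists (q |: D), (x |: S); split.
- by apply/subsetP => y /setU1P[->//|/sX[]].
- move=> y z w /setU1P[->|yS] /setU1P[->|zS] wy wz //.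
  + by case: (far z w).
  + by case: (far y w).
  + exact: pS wy wz.
- by rewrite !cardsU1 xS leq_add // leq_b1.
- move=> y yX; have [yq|nyq] := boolP (cnb y q).
    by exists q; rewrite // setU11.
  have [|u uD yu] := cov y; first by rewrite inE yX nyq.
  by exists u; rewrite // setU1r.
Qed.

End Rooted.

Lemma tree_rooted (G : sgraph) (r : G) : is_tree G ->
  exists p h, towards [set r] p h.
Proof. by move=> tG; apply: tree_towards (set11 r) => //; apply: connected_in1. Qed.

Lemma tree_packing (G : sgraph) : is_tree G ->
  exists2 S : {set G}, packing S & #|S| = domination_number G.
Proof.
move=> tG; have [/card_gt0P[r _] _ _] := tG.
have [p [h ph]] := tree_rooted r tG.
have [D [S [_ pS leD cov]]] := tree_cover ph setT.
exists S => //; apply/eqP; rewrite eqn_leq packing_le_domination_number //.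
apply: leq_trans leD; apply: domination_number_le; apply: cnb_dominating => v.
by apply: cov; rewrite inE.
Qed.

(** * Packings in subdivided trees *)

Section PackingSubdivide.
Variables (G : sgraph) (F : {set {set G}}).
Implicit Types (S : {set G}).

Lemma packingU1 (H : sgraph) (S : {set H}) t : packing S ->
  (forall s w, s \in S -> cnb w t -> cnb w s -> s = t) -> packing (t |: S).
Proof.
move=> pS hS x y w /setU1P[->|xS] /setU1P[->|yS] // wx wy.
- by rewrite (hS y w).
- exact: hS wx.
- exact: pS wx wy.
Qed.

Lemma edgesP (e : {set G}) :
  reflect (exists2 xy : G * G, adj xy.1 xy.2 & e = [set xy.1; xy.2]) (e \in edges G).
Proof.
apply: (iffP imset2P) => [[x y _]|[[x y] /= xy ->]].
  by rewrite inE => xy ->; exists (x, y).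
by exists x y; rewrite ?inE.
Qed.

Lemma mem_edges x y : adj x y -> [set x; y] \in edges G.
Proof. by move=> xy; apply/edgesP; exists (x, y). Qed.

Lemma edge_cnb e x y : e \in edges G -> x \in e -> y \in e -> cnb x y.
Proof.
move=> /edgesP[[a b] /= ab ->]; rewrite !inE /cnb.
by move=> /orP[] /eqP -> /orP[] /eqP ->; rewrite ?eqxx ?ab 1?adj_sym ?ab ?orbT.
Qed.

Lemma cnb_inl w x : @cnb (subdivide F) (inl w) (inl x) =
  (w == x) || adj w x && ([set w; x] \notin F).
Proof. by []. Qed.

Lemma cnb_inr (w : {e | e \in F}) x : @cnb (subdivide F) (inr w) (inl x) = (x \in val w).
Proof. by []. Qed.

Lemma cnb_inlr (w : {e | e \in F}) x : @cnb (subdivide F) (inl x) (inr w) = (x \in val w).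
Proof. by []. Qed.

Lemma cnb_inrr (w e : {e | e \in F}) : @cnb (subdivide F) (inr w) (inr e) = (w == e).
Proof. by rewrite /cnb /= orbF. Qed.

Lemma packing_subdivide S : F \subset edges G -> packing S ->
  @packing (subdivide F) (inl @: S).
Proof.
move=> /subsetP FE pS _ _ w /imsetP[x xS ->] /imsetP[y yS ->].
case: w => [w|e]; last first.
  rewrite !cnb_inr => xe ye; congr inl; apply: (pS x y x) => //.
    by rewrite /cnb eqxx.
  by apply: edge_cnb xe ye; apply/FE/(valP e).
rewrite !cnb_inl => wx wy; congr inl; apply: (pS x y w) => //.
  by case/orP: wx => [/eqP ->|/andP[wx _]]; rewrite /cnb ?eqxx ?wx ?orbT.
by case/orP: wy => [/eqP ->|/andP[wy _]]; rewrite /cnb ?eqxx ?wy ?orbT.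
Qed.

Lemma packing_sd_increasing S (t : subdivide F) :
  F \subset edges G -> packing S -> #|S| = domination_number G ->
  t \notin inl @: S ->
  (forall s w, s \in S -> cnb w t -> cnb w (inl s : subdivide F) -> False) ->
  sd_increasing F.
Proof.
move=> FE pS cS tS ht; rewrite /sd_increasing FE /= -cS.
have -> : #|S|.+1 = #|t |: inl @: S|.
  by rewrite cardsU1 tS card_imset //; move=> x y [].
apply: packing_le_domination_number; apply: packingU1.
  exact: packing_subdivide.
by move=> _ w /imsetP[s sS ->] wt ws; case: (ht s w).
Qed.

End PackingSubdivide.

Section SubdivisionToCode.
Variable G : sgraph.
Hypotheses (tG : is_tree G) (cG : 2 < #|G|).
Hypothesis sd3 : forall F : {set {set G}}, sd_increasing F -> 2 < #|F|.
Implicit Types (S : {set G}) (u v w x y z m s : G).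

Lemma support_in_packing S y z : packing S -> #|S| = domination_number G ->
  leaf z -> z \notin S -> adj z y -> y \in S.
Proof.
move=> pS cS lz zS zy; apply: contraT => yS.
have: sd_increasing [set [set z; y]].
  apply: (packing_sd_increasing (t := inl z) _ pS cS).
  - by rewrite sub1set mem_edges.
  - by rewrite mem_imset //; move=> a b [].
  move=> s [w|e] sS.
    rewrite !cnb_inl => /orP[/eqP ->|/andP[wz]].
      case/orP=> [/eqP zs|/andP[zs]]; first by rewrite zs sS in zS.
      by rewrite (leafP lz zs zy) inE eqxx.
    have -> : w = y by apply: (@leafP _ z) => //; rewrite adj_sym.
    by rewrite setUC inE eqxx.
  rewrite !cnb_inr => _; have /set1P-> := valP e.
  by rewrite !inE => /orP[] /eqP es; [move: zS|move: yS]; rewrite -es sS.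
by move=> /sd3; rewrite cards1.
Qed.

Lemma support_nonleaf y z : leaf z -> adj z y -> ~~ leaf y.
Proof.
move=> lz zy; apply/negP => ly; have [_ conG _] := tG.
have yz : adj y z by rewrite adj_sym.
have cl : closed (@adj G) [set y; z].
  move=> a b ab; rewrite !inE; apply/idP/idP => /orP[] /eqP e; subst.
  - by rewrite (leafP ly ab yz) eqxx orbT.
  - by rewrite (leafP lz ab zy) eqxx.
  - by rewrite adj_sym in ab; rewrite (leafP ly ab yz) eqxx orbT.
  - by rewrite adj_sym in ab; rewrite (leafP lz ab zy) eqxx.
have : [set: G] \subset [set y; z].
  by apply/subsetP => a _; rewrite -(closed_connect cl (conG y a)) !inE eqxx.
move=> /subset_leq_card; rewrite cardsT cards2.
by case: (_ != _); lia.
Qed.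

Lemma max_leaf_packing : exists S,
  [/\ packing S, #|S| = domination_number G & forall z, leaf z -> z \in S].
Proof.
pose Q S := [forall x in S, forall y in S, forall w, cnb w x ==> cnb w y ==> (x == y)]
            && (#|S| == domination_number G).
have QP S : reflect (packing S /\ #|S| = domination_number G) (Q S).
  apply: (iffP andP) => [[/forall_inP h /eqP e]|[pS ->]]; split=> //.
    move=> x y w xS yS wx wy; have /forall_inP/(_ y yS)/forallP/(_ w) := h x xS.
    by rewrite wx wy => /eqP.
  apply/forall_inP => x xS; apply/forall_inP => y yS; apply/forallP => w.
  by apply/implyP => wx; apply/implyP => wy; apply/eqP; apply: pS wx wy.
have [S0 pS0 cS0] := tree_packing tG.
have QS0 : Q S0 by apply/QP.
case: (@arg_maxnP _ S0 Q (fun S => #|[set z in S | leaf z]|) QS0) => S /QP[pS cS] hmax.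
exists S; split=> // z lz; apply: contraT => zS.
have /cards1P[y ey] := lz.
have zy : adj z y by have := set11 y; rewrite -ey inE.
have yS := support_in_packing pS cS lz zS zy.
have ly := support_nonleaf lz zy.
have : Q (z |: S :\ y).
  apply/QP; split; last by rewrite -cS cardsU1 !inE (negbTE zS) andbF (cardsD1 y S) yS.
  apply: packingU1.
    by move=> a b w /setD1P[_ aS] /setD1P[_ bS]; apply: pS.
  move=> s w /setD1P[sy sS] wz ws; case/eqP: sy.
  apply: (pS s y w) => //; case/orP: wz => [/eqP ->|wz].
    by rewrite /cnb zy orbT.
  have -> : w = y by apply: (@leafP _ z) => //; rewrite adj_sym.
  by rewrite /cnb eqxx.
move=> Q'; have : _ <= _ := hmax _ Q'.
rewrite leqNgt => /negP[]; apply: proper_card; apply/properP; split.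
  apply/subsetP => s; rewrite !inE => /andP[sS ls]; rewrite sS ls !andbT.
  by rewrite orbC; apply/orP; left; apply: contraTneq ls => ->.
by exists z; rewrite !inE ?eqxx ?lz ?(negbTE zS).
Qed.

Lemma packing_dominating S : packing S -> #|S| = domination_number G -> dominating S.
Proof.
move=> pS cS; apply: cnb_dominating => u; apply/exists_inP; apply: contraT.
move=> /exists_inPn nu.
have uS : u \notin S by apply/negP => /nu; rewrite /cnb eqxx.
have [m [s [sS mu ms]]] : exists m s, [/\ s \in S, cnb m u & cnb m s].
  have [/existsP[m /exists_inP[s sS /andP[]]]|none] :=
    boolP [exists m, exists s in S, cnb m u && cnb m s]; first by exists m, s.
  have : packing (u |: S).
    apply: packingU1 => // s m sS mu ms; case/negP: none.
    by apply/existsP; exists m; apply/exists_inP; exists s; rewrite // mu ms.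
  by move/packing_le_domination_number; rewrite cardsU1 uS cS; lia.
have um : adj u m.
  move: mu; rewrite cnb_sym => /orP[/eqP e|//].
  by move: (nu s sS); rewrite e ms.
have mS : m \notin S by apply/negP => /nu; rewrite /cnb um orbT.
have {}ms : adj m s.
  by case/orP: ms => [/eqP e|//]; rewrite e sS in mS.
pose F : {set {set G}} := [set [set u; m]; [set m; s]].
have eF : [set u; m] \in F by rewrite !inE eqxx.
have: sd_increasing F.
  apply: (@packing_sd_increasing _ _ _ (inr (exist (fun e => e \in F) _ eF)) _ pS cS).
  - by apply/subsetP => e; rewrite !inE => /orP[] /eqP ->; apply: mem_edges.
  - by apply/imsetP => -[].
  move=> s' [w|e] s'S.
    rewrite cnb_inlr cnb_inl /= !inE => /orP[] /eqP ->.
      have := nu s' s'S; rewrite /cnb negb_or => /andP[/negbTE -> /negbTE ->].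
      by [].
    case/orP=> [/eqP e|/andP[ms' nF]]; first by rewrite e s'S in mS.
    case/negP: nF; rewrite (pS s' s m) ?eqxx ?orbT // /cnb ?ms ?ms' ?orbT //.
  rewrite cnb_inrr cnb_inr => /eqP -> /=; rewrite !inE => /orP[] /eqP es.
    by rewrite es (negbTE uS) in s'S.
  by rewrite es (negbTE mS) in s'S.
by move=> /sd3; rewrite cards2; case: (_ != _).
Qed.

Lemma sd3_leaf_code : exists S, leaf_code S.
Proof.
have [S [pS cS lS]] := max_leaf_packing.
exists S; apply/leaf_codeP; split=> //; first exact: packing_dominating.
exact/packingP.
Qed.

End SubdivisionToCode.


(** * Subdividing at most three edges *)

Section RaisingEdges.
Variable G : sgraph.
Hypothesis tG : is_tree G.
Implicit Types (D R S : {set G}) (u v w x y a b c d : G).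

Lemma tree_nbr v : 1 < #|G| -> exists u, adj v u.
Proof.
move=> G1; have [_ conG _] := tG.
have [u uv] : exists u, u != v.
  apply/existsP; apply: contraTT G1 => /existsPn h; rewrite -leqNgt.
  rewrite -(cards1 v) -cardsT; apply/subset_leq_card/subsetP => u _.
  by have := h u; rewrite negbK inE.
have /connectP[[|w p] /=] := conG v u; first by move=> _ e; rewrite e eqxx in uv.
by case/andP=> vw _ _; exists w.
Qed.

Lemma tree_triangle a b c : adj a b -> adj b c -> adj a c -> False.
Proof.
move=> ab bc ac; have [_ _ acyc] := tG.
suff /acyc : ucycle (@adj G) [:: a; b; c] by [].
rewrite /ucycle /= ab bc adj_sym ac !inE !negb_or.
by rewrite (adj_neq ab) (adj_neq bc) (adj_neq ac).
Qed.

Lemma code_sd_increasing D : 1 < #|G| -> leaf_code D ->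
  exists2 F : {set {set G}}, sd_increasing F & #|F| = 3.
Proof.
move=> G1 cD.
have [a aD] : exists a, a \notin D.
  have [/card_gt0P[r _] _ _] := tG.
  have [rD|] := boolP (r \in D); last by exists r.
  have [u ru] := tree_nbr r G1; exists u; apply/negP => uD.
  by rewrite (code_indep cD) in ru.
have [c cD' ac] := code_dom cD aD; have [b bD ab] := code_free cD aD.
have [d dD bd] := code_dom cD bD.
have neq x y : x \in D -> y \notin D -> (x == y) = false.
  by move=> xD yD; apply: contraNF yD => /eqP <-.
have cd : (c == d) = false.
  by apply/negP => /eqP e; rewrite -e in bd; apply: (tree_triangle ab bd ac).
pose e := [set a; b].
pose F : {set {set G}} := [set c; a] |: (e |: [set [set b; d]]).
have eF : e \in F by rewrite !inE eqxx orbT.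
exists F.
  apply: (@packing_sd_increasing _ _ D (inr (exist (fun e => e \in F) _ eF))).
  - by apply/subsetP => x; rewrite !inE => /or3P[] /eqP ->;
      apply: mem_edges; rewrite // adj_sym.
  - exact: code_packing.
  - exact: code_card.
  - by apply/imsetP => -[].
  move=> s [w|x] sD.
    rewrite cnb_inlr cnb_inl /= /e !inE eq_sym => /orP[] /eqP e'; subst w.
      rewrite eq_sym neq //= => /andP[as_ /negP[]].
      by rewrite (code_inj cD sD cD' as_ ac) setUC eqxx.
    rewrite eq_sym neq //= => /andP[bs /negP[]].
    by rewrite (code_inj cD sD dD bs bd) eqxx !orbT.
  rewrite cnb_inrr cnb_inr => /eqP -> /=; rewrite !inE !neq //.
have ne (A B : {set G}) x : x \in A -> x \notin B -> (A == B) = false.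
  by move=> xA xB; apply: contraNF xB => /eqP <-.
have ce : c \in [set c; a] by rewrite !inE eqxx.
have de : d \in [set b; d] by rewrite !inE eqxx orbT.
have n1 : ([set c; a] == e) = false.
  by apply: ne ce _; rewrite !inE !neq.
have n2 : ([set c; a] == [set b; d]) = false.
  by apply: ne ce _; rewrite !inE neq // cd.
have n3 : ([set b; d] == e) = false.
  by apply: ne de _; rewrite !inE !neq.
by rewrite !cardsU1 cards1 !inE n1 n2 eq_sym n3.
Qed.

Lemma path_chord x y s z : path (@adj G) x (y :: s) -> uniq (x :: y :: s) ->
  z \in y :: s -> adj x z -> z = y.
Proof.
move=> /= /andP[xy ys] /andP[xN _] zs xz.
apply: (connected_in_nbr tG (path_connected_in ys) _ _ _ xz xy); rewrite in_set //.
by rewrite inE eqxx.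
Qed.

Lemma path_from_edge e c : e \in edges G -> exists x y s,
  [/\ e = [set x; y], path (@adj G) x (y :: s), uniq (x :: y :: s) & last y s = c].
Proof.
case/edgesP=> -[a b] /= ab ->; have [_ conG _] := tG.
have /connectP[p0 pp e0] := conG a c; move: e0.
case/shortenP: pp => p pp up _ ec.
have [bp|bp] := boolP (b \in a :: p); last first.
  exists b, a, p; split=> //; first exact: setUC.
    by rewrite /= adj_sym ab.
  by rewrite bp.
have {}bp : b \in p.
  by move: bp; rewrite inE => /predU1P[ba|//]; rewrite ba adj_irrefl in ab.
case: p pp up ec bp => // y s pp up ec bs.
have eb := path_chord pp up bs ab; subst b.
by exists a, y, s.
Qed.

(* [R] is the set of vertices of a path having [e] and [f] as its end edges. *)
Lemma edges_path e f : e \in edges G -> f \in edges G ->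
  exists R y0 y1 z0 z1,
  [/\ connected_in R,
      [/\ e = [set y0; y1], f = [set z0; z1] & y0 != z0],
      [/\ y0 \in R, y1 \in R, z0 \in R & z1 \in R],
      adj y0 y1 /\ (forall u, u \in R -> adj y0 u -> u = y1)
    & adj z0 z1 /\ (forall u, u \in R -> adj z0 u -> u = z1)].
Proof.
move=> eE /edgesP[[c d] /= cd ->].
have [x [y [s [-> ps us ls]]]] := path_from_edge c eE.
have chord t z : path (@adj G) x (y :: t) -> uniq (x :: y :: t) ->
    z \in [set a in x :: y :: t] -> adj x z -> z = y.
  move=> pt ut zs xz; apply: (path_chord pt ut _ xz).
  by move: zs; rewrite in_set in_cons => /predU1P[e'|//]; rewrite e' adj_irrefl in xz.
have xy : adj x y by case/andP: ps.
have cs : c \in y :: s by rewrite -ls mem_last.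
have [dp|dp] := boolP (d \in x :: y :: s).
  exists [set a in x :: y :: s], x, y, c, d; split.
  - exact: path_connected_in.
  - split=> //; move: us; rewrite cons_uniq => /andP[xN _].
    by apply: contraNneq xN => ->.
  - by split; rewrite in_set ?dp // in_cons ?cs ?orbT // in_cons eqxx ?orbT.
  - by split=> // u; apply: chord.
  split=> // u uR cu; move: us ps ls cs uR dp.
  case/lastP: s => [|q c'].
    move=> /= _ _ -> _; rewrite !inE.
    move=> /orP[/eqP ->|/eqP ec] /orP[/eqP ->|/eqP ed] //.
    + by rewrite ed adj_irrefl in cd.
    + by rewrite ec adj_irrefl in cu.
    + by rewrite ed adj_irrefl in cd.
  rewrite last_rcons -rcons_cons -rcons_cons => us ps ec _ uR dp; subst c'.
  have pq : path (@adj G) x (y :: q).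
    by move: ps; rewrite rcons_path => /andP[].
  move: us; rewrite rcons_uniq => /andP[cN _].
  apply: (connected_in_nbr tG (path_connected_in pq) _ _ _ cu cd).
  - by rewrite in_set.
  - move: uR; rewrite !in_set mem_rcons in_cons => /predU1P[e'|//].
    by rewrite e' adj_irrefl in cu.
  - move: dp; rewrite in_set mem_rcons in_cons => /predU1P[e'|//].
    by rewrite e' adj_irrefl in cd.
have pd : path (@adj G) x (y :: rcons s d).
  by rewrite -rcons_cons rcons_path ps /= ls.
have ud : uniq (x :: y :: rcons s d) by rewrite -!rcons_cons rcons_uniq dp us.
exists [set a in x :: y :: rcons s d], x, y, d, c; split.
- exact: path_connected_in.
- split=> //; first exact: setUC.
  by apply: contraNneq dp => <-; rewrite inE eqxx.
- by split; rewrite in_set -!rcons_cons mem_rcons 2!in_cons ?cs ?eqxx ?orbT // in_cons eqxx !orbT.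
- by split=> // u; apply: chord.
split=> [|u uR du]; first by rewrite adj_sym.
rewrite adj_sym in cd.
apply: (connected_in_nbr tG (path_connected_in ps) _ _ _ du cd).
- by rewrite in_set.
- move: uR; rewrite !in_set -!rcons_cons mem_rcons inE => /predU1P[e'|//].
  by rewrite e' adj_irrefl in du.
- by rewrite in_set inE cs orbT.
Qed.

End RaisingEdges.

Section Ends.
Variables (G : sgraph) (D R : {set G}) (p : G -> G) (h : G -> nat).
Hypotheses (cD : leaf_code D) (ph : towards R p h).
Variables (F : {set {set G}}) (E : {set subdivide F}).
Hypothesis FR : forall u v : G, [set u; v] \in F -> u \in R /\ v \in R.
Hypothesis Eout : forall w : G, w \in D -> w \notin R -> (inl (p w) : subdivide F) \in E.

Lemma child_chosen v b : v \notin D -> b \notin D -> b \notin R -> p b = v ->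
  (inl b : subdivide F) \in E.
Proof.
move=> vD bD bR pb; have [c cD' bc] := code_dom cD bD.
case: (towards_edge ph bc) => -[cR pc].
- by rewrite cR in bR.
- by rewrite -pb pc cD' in vD.
- by rewrite -pc; apply: Eout.
Qed.

Lemma outside_dominated v : v \notin R ->
  exists2 u, u \in E & cnb (inl v : subdivide F) u.
Proof.
have out a b : a \notin R -> adj a b -> cnb (inl a : subdivide F) (inl b).
  move=> aR ab; rewrite cnb_inl ab /= orbC.
  by rewrite (contraNN _ aR) // => /FR[].
move=> vR; have vp := towards_adj ph vR.
have [vD|vD] := boolP (v \in D).
  by exists (inl (p v)); [apply: Eout|apply: out].
have [c cD' vc] := code_dom cD vD.
case: (towards_edge ph vc) => -[].
- by rewrite (negbTE vR).
- move=> _ pv; have [b bD vb] := code_free cD vD.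
  exists (inl b); last exact: out.
  case: (towards_edge ph vb) => -[].
  + by rewrite (negbTE vR).
  + by move=> _ pv'; rewrite -pv' pv cD' in bD.
  + exact: child_chosen.
- by move=> cR <-; exists (inl (p c)); [apply: Eout|rewrite /cnb eqxx].
Qed.

Variables y0 y1 : G.
Hypothesis y0R : y0 \in R.
Hypothesis y0_end : forall u : G, u \in R -> adj y0 u -> u = y1.

Lemma end_dominated : y0 \notin D -> y1 \in D ->
  exists2 u, u \in E & cnb (inl y0 : subdivide F) u.
Proof.
move=> y0D y1D; have [b bD y0b] := code_free cD y0D.
have bR : b \notin R by apply/negP => /y0_end/(_ y0b) e; rewrite e y1D in bD.
exists (inl b).
  by case: (towards_edge ph y0b) => -[]; rewrite ?y0R ?(negbTE bR) // => _;
    apply: child_chosen.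
rewrite cnb_inl y0b /= orbC.
by rewrite (contraNN _ bR) // => /FR[].
Qed.

End Ends.

Section FewEdges.
Variables (G : sgraph) (D : {set G}).
Hypotheses (tG : is_tree G) (cD : leaf_code D).

Lemma two_edges_not_increasing e f : e \in edges G -> f \in edges G ->
  domination_number (subdivide [set e; f]) <= #|D|.
Proof.
move=> eE fE.
have [R [y0 [y1 [z0 [z1 [cR [ee ef yz] [y0R y1R z0R z1R] [y01 y0e] [z01 z0e]]]]]]] :=
  edges_path tG eE fE.
have [p [h ph]] := tree_towards tG cR y0R.
set F := [set e; f].
have eF : e \in F by rewrite !inE eqxx.
have fF : f \in F by rewrite !inE eqxx orbT.
pose xe : subdivide F := inr (exist (fun e => e \in F) e eF).
pose xf : subdivide F := inr (exist (fun e => e \in F) f fF).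
pose g w : subdivide F := if w \notin R then inl (p w) else
  if w == y0 then xe else if w == z0 then xf else inl w.
pose E := g @: D.
have Eout w : w \in D -> w \notin R -> (inl (p w) : subdivide F) \in E.
  by move=> wD wR; apply/imsetP; exists w; rewrite // /g wR.
have Ee : y0 \in D -> xe \in E.
  by move=> yD; apply/imsetP; exists y0; rewrite // /g y0R eqxx.
have Ef : z0 \in D -> xf \in E.
  by move=> zD; apply/imsetP; exists z0; rewrite // /g z0R eqxx eq_sym (negbTE yz).
have Ein w : w \in D -> w \in R -> w != y0 -> w != z0 -> (inl w : subdivide F) \in E.
  by move=> wD wR wy wz; apply/imsetP; exists w; rewrite // /g wR (negbTE wy) (negbTE wz).
have inR u : (u \in e) || (u \in f) -> u \in R.
  by rewrite ee ef !inE -orbA => /or4P[] /eqP ->.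
have FR u v : [set u; v] \in F -> u \in R /\ v \in R.
  rewrite !inE => /orP[] /eqP uv; split; apply: inR;
  by rewrite -uv !inE eqxx ?orbT.
have cself (x : subdivide F) : cnb x x by rewrite /cnb eqxx.
apply: leq_trans (leq_imset_card g D); rewrite -/E.
apply: domination_number_le; apply: cnb_dominating.
have cov_e (x : {e | e \in F}) : val x = e -> exists2 u, u \in E & cnb (inr x : subdivide F) u.
  move=> xe_; have {xe_}-> : x = exist (fun e => e \in F) e eF by exact: val_inj.
  have [/Ee|y0D] := boolP (y0 \in D); first by exists xe; rewrite ?cself.
  have [c cD' y0c] := code_dom cD y0D.
  have [cR'|cR'] := boolP (c \in R); last first.
    exists (inl y0); last by rewrite cnb_inr /= ee !inE eqxx.
    case: (towards_edge ph y0c) => -[]; rewrite ?y0R ?(negbTE cR') // => _ <-.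
    exact: Eout.
  have e1 := y0e c cR' y0c; subst c.
  have [e1|y1z] := eqVneq y1 z0.
    exists xf; first by apply: Ef; rewrite -e1.
    suff fe : f = e.
      by rewrite cnb_inrr -val_eqE /= fe.
    by rewrite ef ee -e1 setUC; congr [set _; _]; rewrite -(z0e y0) // -e1 adj_sym.
  exists (inl y1); last by rewrite cnb_inr /= ee !inE eqxx orbT.
  by apply: Ein => //; rewrite eq_sym adj_neq.
have cov_f (x : {e | e \in F}) : val x = f -> exists2 u, u \in E & cnb (inr x : subdivide F) u.
  move=> xe_; have {xe_}-> : x = exist (fun e => e \in F) f fF by exact: val_inj.
  have [/Ef|y0D] := boolP (z0 \in D); first by exists xf; rewrite ?cself.
  have [c cD' y0c] := code_dom cD y0D.
  have [cR'|cR'] := boolP (c \in R); last first.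
    exists (inl z0); last by rewrite cnb_inr /= ef !inE eqxx.
    case: (towards_edge ph y0c) => -[]; rewrite ?z0R ?(negbTE cR') // => _ <-.
    exact: Eout.
  have e1 := z0e c cR' y0c; subst c.
  have [e1|y1z] := eqVneq z1 y0.
    exists xe; first by apply: Ee; rewrite -e1.
    suff fe : f = e.
      by rewrite cnb_inrr -val_eqE /= fe.
    by rewrite ef ee -e1 setUC; congr [set _; _]; rewrite -(y0e z0) // -e1 adj_sym.
  exists (inl z1); last by rewrite cnb_inr /= ef !inE eqxx orbT.
  by apply: Ein => //; rewrite eq_sym adj_neq.
case=> [v|x]; last by case/set2P: (valP x) => [/cov_e|/cov_f].
have [vR|vR] := boolP (v \in R); last exact: (outside_dominated cD ph FR Eout vR).
have [vD|vD] := boolP (v \in D).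
  have [ey|vy] := eqVneq v y0.
    by exists xe; [apply: Ee; rewrite -ey|rewrite cnb_inlr /= ee ey !inE eqxx].
  have [ez|vz] := eqVneq v z0.
    by exists xf; [apply: Ef; rewrite -ez|rewrite cnb_inlr /= ef ez !inE eqxx].
  by exists (inl v); [apply: Ein|].
have [w wD vw] := code_dom cD vD.
have [wR|wR] := boolP (w \in R); last first.
  exists (inl v) => //; case: (towards_edge ph vw) => -[]; rewrite ?vR ?(negbTE wR) // => _ <-.
  exact: Eout.
have [ey|wy] := eqVneq w y0.
  subst w; exists xe; first exact: Ee.
  by rewrite cnb_inlr /= ee (y0e v) // 1?adj_sym // !inE eqxx orbT.
have [ez|wz] := eqVneq w z0.
  subst w; exists xf; first exact: Ef.
  by rewrite cnb_inlr /= ef (z0e v) // 1?adj_sym // !inE eqxx orbT.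
have [vwF|vwF] := boolP ([set v; w] \in F); last first.
  by exists (inl w); [apply: Ein|rewrite cnb_inl vw vwF orbT].
have vwd : v != w by apply: adj_neq.
have: w \in [set v; w] /\ v \in [set v; w] by rewrite !inE !eqxx orbT.
case/set2P: vwF => ->; rewrite ?ee ?ef !inE.
  rewrite (negbTE wy) /= => -[/eqP ew /orP[/eqP ev|/eqP ev]]; subst.
    exact: (end_dominated cD ph FR Eout y0R y0e).
  by rewrite eqxx in vwd.
rewrite (negbTE wz) /= => -[/eqP ew /orP[/eqP ev|/eqP ev]]; subst.
  exact: (end_dominated cD ph FR Eout z0R z0e).
by rewrite eqxx in vwd.
Qed.

Lemma code_sd_lower (F : {set {set G}}) : sd_increasing F -> 2 < #|F|.
Proof.
case/andP=> FE; rewrite -(code_card cD) ltnNge; apply: contraNT; rewrite -leqNgt => leF.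
have [->|[e eF]] := set_0Vmem F.
  rewrite -(card_imset (mem D) (_ : injective (inl : G -> subdivide set0))); last by move=> ? ? [].
  apply: domination_number_le; apply: cnb_dominating => -[v|x]; last first.
    by have := valP x; rewrite inE.
  have [u uD vu] := dominating_cnb v (code_dominating cD).
  exists (inl u); first exact: imset_f.
  by rewrite cnb_inl inE andbT.
have [f fF ->] : exists2 f, f \in F & F = [set e; f].
  have [F1|[f]] := set_0Vmem (F :\ e).
    by exists e; rewrite // -(setD1K eF) F1 setU0 setUid.
  rewrite !inE => /andP[fe fF]; exists f => //; apply/esym/eqP.
  rewrite eqEcard cards2 eq_sym fe leF andbT.
  by apply/subsetP => x; rewrite !inE => /orP[] /eqP ->.
by apply: two_edges_not_increasing; apply: (subsetP FE).
Qed.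

Lemma code_sd3 : 1 < #|G| -> sd_number_is G 3.
Proof.
by move=> G1; split; [apply: code_sd_increasing G1 cD|apply: code_sd_lower].
Qed.

End FewEdges.


Section Unique.
Variables (G : sgraph) (r : G) (p : G -> G) (h : G -> nat).
Hypothesis ph : towards [set r] p h.

(* The deepest vertex of a symmetric difference of codes cannot exist: the
   codes alternate along [u], [v], [w], [x], each vertex the parent of the next. *)
Lemma code_diff_deepest (D D' : {set G}) v : leaf_code D -> leaf_code D' ->
  v \in D -> v \notin D' ->
  (forall x, (x \in D) != (x \in D') -> h x <= h v) -> False.
Proof.
move=> cD cD' vD vD' hmax.
have [u uD' vu] := code_dom cD' vD'.
have uD : u \notin D by apply/negP => uD; rewrite (code_indep cD) in vu.
have hu : h u <= h v by apply: hmax; rewrite uD' (negbTE uD).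
have pv : p v = u by case: (rooted_edge ph vu) => -[//] _ _ hu'; lia.
have [w wD' vw] := code_free cD' vD'.
have wu : w != u by apply: contraNneq wD' => ->.
have pw : p w = v.
  by case: (rooted_edge ph vw) => -[//] _ e _; rewrite -e pv eqxx in wu.
have [x xD' wx] := code_dom cD' wD'.
have xv : x != v by apply: contraNneq vD' => <-.
have [_ px hx] : [/\ x != r, p x = w & h x = (h w).+1].
  by case: (rooted_edge ph wx) => -[] // _ e _; rewrite -e pw eqxx in xv.
have hw : h w = (h v).+1.
  by case: (rooted_edge ph vw) => -[] // _ e _; rewrite -e pv eqxx in wu.
have xD : x \notin D.
  by apply: contra xv => xD; rewrite (code_inj cD xD vD wx) // adj_sym.
have := hmax x; rewrite xD' (negbTE xD) => /(_ isT); lia.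
Qed.

End Unique.

Lemma tree_code_unique (G : sgraph) (D D' : {set G}) : is_tree G ->
  leaf_code D -> leaf_code D' -> D = D'.
Proof.
move=> tG cD cD'; have [/card_gt0P[r _] _ _] := tG.
have [p [h ph]] := tree_rooted r tG.
apply/setP => x0; apply/eqP; apply: contraT => x0D.
case: (@arg_maxnP _ x0 (fun x => (x \in D) != (x \in D')) h x0D) => v vD hmax.
have [vin|vin] := boolP (v \in D).
  move: vD; rewrite vin; case: (boolP (v \in D')) => // vin' _.
  by case: (code_diff_deepest ph cD cD' vin vin').
move: vD; rewrite (negbTE vin); case: (boolP (v \in D')) => // vin' _.
case: (code_diff_deepest ph cD' cD vin' vin) => x xD; apply: hmax.
by rewrite eq_sym.
Qed.

Lemma giso_leaf_code (G H : sgraph) (f : G -> H) (D : {set H}) :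
  bijective f -> {mono f : x y / adj x y} -> leaf_code D -> leaf_code (f @^-1: D).
Proof.
move=> [g fK gK] fm cD; split.
- by move=> x y; rewrite !inE -fm; apply: (code_indep cD).
- move=> v x y; rewrite !inE -!fm => xD yD vx vy.
  exact: can_inj fK _ _ (code_inj cD xD yD vx vy).
- move=> v; rewrite inE => /(code_dom cD)[c cD' vc].
  by exists (g c); rewrite ?inE -?fm gK.
- move=> v; rewrite inE => /(code_free cD)[c cD' vc].
  by exists (g c); rewrite ?inE -?fm gK.
Qed.

Definition is_LA l := if l is LA then true else false.

Definition label_code (G : lgraph) : {set G} := [set x | is_LA (lab x)].

(** * Labelled trees *)

Section AttachCode.
Variables (G : lgraph) (v : G).

Lemma mem_label_code_inl s x : ((inl x : attach v s) \in label_code _) = (x \in label_code G).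
Proof. by rewrite !inE. Qed.

Lemma mem_label_code_inr s i : ((inr i : attach v s) \in label_code _) = is_LA (nth LA s i).
Proof. by rewrite !inE. Qed.

Lemma attach_A_code : leaf_code (label_code G) -> lab v = LA ->
  leaf_code (label_code (attach v [:: LB; LB; LA])).
Proof.
move=> cG vA; have vG : v \in label_code G by rewrite inE vA.
pose o i (lt : i < 3) : attach v [:: LB; LB; LA] := inr (Ordinal lt).
split.
- move=> [x|[[|[|[|//]]] lx]] [y|[[|[|[|//]]] ly]];
    rewrite ?mem_label_code_inl ?mem_label_code_inr //=.
  + by apply: (code_indep cG).
  + by rewrite andbF.
  + by rewrite andbF.
- move=> [u|[[|[|[|//]]] lu]] [x|[[|[|[|//]]] lx]] [y|[[|[|[|//]]] ly]];
    rewrite ?mem_label_code_inl ?mem_label_code_inr //= ?andbF //.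
  + by move=> xG yG ux uy; congr inl; apply: (code_inj cG xG yG ux uy).
  + by move=> _ _; rewrite !andbT => /eqP -> /eqP ->.
  + by move=> _ _ _ _; congr inr; apply: val_inj.
- move=> [u|[[|[|[|//]]] lu]]; rewrite ?mem_label_code_inl ?mem_label_code_inr //.
  + move=> /(code_dom cG)[c cD uc]; exists (inl c) => //.
    by rewrite mem_label_code_inl.
  + by move=> _; exists (inl v); rewrite ?mem_label_code_inl //= eqxx.
  + by move=> _; exists (o 2 isT); rewrite ?mem_label_code_inr.
- move=> [u|[[|[|[|//]]] lu]]; rewrite ?mem_label_code_inl ?mem_label_code_inr //.
  + move=> /(code_free cG)[c cD uc]; exists (inl c) => //.
    by rewrite mem_label_code_inl.
  + by move=> _; exists (o 1 isT); rewrite ?mem_label_code_inr.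
  + by move=> _; exists (o 0 isT); rewrite ?mem_label_code_inr.
Qed.

Lemma attach_B_code : leaf_code (label_code G) -> lab v = LB ->
  leaf_code (label_code (attach v [:: LB; LA])).
Proof.
move=> cG vB; have vG : v \notin label_code G by rewrite inE vB.
pose o i (lt : i < 2) : attach v [:: LB; LA] := inr (Ordinal lt).
split.
- move=> [x|[[|[|//]] lx]] [y|[[|[|//]] ly]];
    rewrite ?mem_label_code_inl ?mem_label_code_inr //=.
  + by apply: (code_indep cG).
  + by rewrite andbF.
  + by rewrite andbF.
- move=> [u|[[|[|//]] lu]] [x|[[|[|//]] lx]] [y|[[|[|//]] ly]];
    rewrite ?mem_label_code_inl ?mem_label_code_inr //= ?andbF //.
  + by move=> xG yG ux uy; congr inl; apply: (code_inj cG xG yG ux uy).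
  + by move=> xG _ /andP[/eqP xv]; rewrite -xv xG in vG.
  + by move=> xG _ /andP[/eqP xv]; rewrite -xv xG in vG.
  + by move=> _ xG _ /andP[/eqP xv]; rewrite -xv xG in vG.
  + by move=> _ _ _ _; congr inr; apply: val_inj.
- move=> [u|[[|[|//]] lu]]; rewrite ?mem_label_code_inl ?mem_label_code_inr //.
  + move=> /(code_dom cG)[c cD uc]; exists (inl c) => //.
    by rewrite mem_label_code_inl.
  + by move=> _; exists (o 1 isT); rewrite ?mem_label_code_inr.
- move=> [u|[[|[|//]] lu]]; rewrite ?mem_label_code_inl ?mem_label_code_inr //.
  + move=> /(code_free cG)[c cD uc]; exists (inl c) => //.
    by rewrite mem_label_code_inl.
  + by move=> _; exists (inl v); rewrite ?mem_label_code_inl //= eqxx.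
Qed.

End AttachCode.

Lemma P4_code : leaf_code (label_code (labelled_path [:: LA; LB; LB; LA])).
Proof.
pose o i (lt : i < 4) : labelled_path [:: LA; LB; LB; LA] := Ordinal lt.
split.
- by move=> [[|[|[|[|//]]]] lx] [[|[|[|[|//]]]] ly]; rewrite !inE.
- move=> [[|[|[|[|//]]]] lu] [[|[|[|[|//]]]] lx] [[|[|[|[|//]]]] ly]; rewrite !inE //;
  by move=> _ _ _ _; apply: val_inj.
- move=> [[|[|[|[|//]]]] lu]; rewrite !inE // => _.
  + by exists (o 0 isT); rewrite ?inE.
  + by exists (o 3 isT); rewrite ?inE.
- move=> [[|[|[|[|//]]]] lu]; rewrite !inE // => _.
  + by exists (o 2 isT); rewrite ?inE.
  + by exists (o 1 isT); rewrite ?inE.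
Qed.

Lemma family_code (G : lgraph) : family_F G -> leaf_code (label_code G).
Proof.
elim=> {G} [|G v _ cG vA|G v _ cG vB|G H [f [bf mf lf]] _ cG].
- exact: P4_code.
- exact: attach_A_code.
- exact: attach_B_code.
have [g fK gK] := bf.
have -> : label_code H = g @^-1: label_code G.
  by apply/setP => x; rewrite !inE -lf gK.
apply: giso_leaf_code cG; first by exists f.
by move=> x y; rewrite -mf !gK.
Qed.

Section Induced.
Variables (G : sgraph) (S : {set G}).

Definition induced_adj : rel {x : G | x \in S} := fun x y => adj (val x) (val y).

Lemma induced_sym : symmetric induced_adj.
Proof. by move=> x y; apply: adj_sym. Qed.

Lemma induced_irrefl : irreflexive induced_adj.
Proof. by move=> x; apply: adj_irrefl. Qed.

Definition induced := SGraph induced_sym induced_irrefl.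

Lemma induced_tree r p h : @towards G [set r] p h -> r \in S ->
  (forall v, v \in S -> v != r -> p v \in S) -> is_tree induced.
Proof.
move=> ph rS pS; pose r' : induced := exist (fun x => x \in S) r rS.
pose p' (v : induced) : induced := insubd v (p (val v)).
have p'E v : v != r' -> val (p' v) = p (val v).
  by move=> vr; rewrite val_insubd pS // (valP v).
apply: (@rooted_tree _ r' p' (fun v => h (val v))).
- move=> v vr; rewrite /= /induced_adj p'E //.
  by have [] := rooted_parent ph (vr : val v != r).
- move=> v vr; rewrite p'E //.
  by have [_ ->] := rooted_parent ph (vr : val v != r).
- move=> u v uv; case: (rooted_edge ph (uv : adj (val u) (val v))) => -[ur e _].
    by left; split=> //; apply: val_inj; rewrite p'E.
  by right; split=> //; apply: val_inj; rewrite p'E.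
Qed.

Definition code_in (D : {set G}) : {set induced} := [set x | val x \in D].

Lemma induced_code D q : leaf_code D ->
  (forall s t, s \in S -> t \notin S -> adj s t -> s = q) ->
  q \in D \/ (exists c b, [/\ c \in D :&: S, b \in S :\: D, adj q c & adj q b]) ->
  leaf_code (code_in D).
Proof.
move=> cD only_q hq; split.
- by move=> x y; rewrite !inE; apply: (code_indep cD).
- move=> v x y; rewrite !inE => xD yD vx vy; apply: val_inj.
  exact: (code_inj cD xD yD vx vy).
- move=> v; rewrite inE => vD.
  have [c cD' [cS vc]] : exists2 c, c \in D & c \in S /\ adj (val v) c.
    have [c cD' vc] := code_dom cD vD.
    have [cS|cS] := boolP (c \in S); first by exists c.
    have vq := only_q _ _ (valP v) cS vc; rewrite -vq (negbTE vD) in hq.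
    case: hq => // -[c' [b []]]; rewrite inE => /andP[c'D c'S] _ qc' _.
    by exists c'.
  by exists (exist (fun x => x \in S) c cS); rewrite ?inE.
- move=> v; rewrite inE => vD.
  have [c cD' [cS vc]] : exists2 c, c \notin D & c \in S /\ adj (val v) c.
    have [c cD' vc] := code_free cD vD.
    have [cS|cS] := boolP (c \in S); first by exists c.
    have vq := only_q _ _ (valP v) cS vc; rewrite -vq (negbTE vD) in hq.
    case: hq => // -[c' [b []]] _; rewrite inE => /andP[bD bS] _ qb.
    by exists b.
  by exists (exist (fun x => x \in S) c cS); rewrite ?inE.
Qed.

End Induced.

Definition code_label (G : sgraph) (D : {set G}) x := if x \in D then LA else LB.

Lemma attach_liso (G : sgraph) (D S : {set G}) (ws : seq G) (v0 : G) (q : induced S)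
    (ls := [seq code_label D x | x <- ws]) :
  uniq ws -> S = [set x | x \notin ws] ->
  (forall i j, i < size ws -> j < size ws ->
    adj (nth v0 ws i) (nth v0 ws j) = (i.+1 == j) || (j.+1 == i)) ->
  (forall x i, x \in S -> i < size ws ->
     adj x (nth v0 ws i) = (x == val q) && (i == 0)) ->
  liso (@attach (@LGraph (induced S) (code_label (code_in S D))) q ls)
       (@LGraph G (code_label D)).
Proof.
move=> uw eS aw ax.
have sl : size ls = size ws by rewrite size_map.
have ltw (i : 'I_(size ls)) : i < size ws by rewrite -sl.
pose f (x : (@LGraph (induced S) (code_label (code_in S D)) : sgraph) + 'I_(size ls)) : G :=
  match x with inl x => val x | inr i => nth v0 ws i end.
have nS (i : 'I_(size ls)) : nth v0 ws i \notin S by rewrite eS inE negbK mem_nth.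
have injf : injective f.
  case=> [x|i] [y|j] /= e.
  - by congr inl; apply: val_inj.
  - by have := nS j; rewrite -e (valP x).
  - by have := nS i; rewrite e (valP y).
  - by congr inr; apply: val_inj; apply/eqP; rewrite -(nth_uniq v0 (ltw i) (ltw j) uw) e.
exists f; split.
- apply: inj_card_bij injf _.
  rewrite card_sum card_sig card_ord sl -(card_uniqP uw) -(cardC (mem S)) leq_add //.
  apply: subset_leq_card; apply/subsetP => x; rewrite !inE eS inE negbK //.
- case=> [x|i] [y|j] //=.
  + by rewrite ax // (valP x).
  + by rewrite adj_sym ax // (valP y).
  + by rewrite aw.
- case=> [x|i] /=; first by rewrite /code_label inE.
  by rewrite (nth_map v0).
Qed.


Lemma path_liso (G : sgraph) (D : {set G}) (ws : seq G) (v0 : G)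
    (ls := [seq code_label D x | x <- ws]) :
  uniq ws -> (forall x, x \in ws) ->
  (forall i j, i < size ws -> j < size ws ->
    adj (nth v0 ws i) (nth v0 ws j) = (i.+1 == j) || (j.+1 == i)) ->
  liso (labelled_path ls) (@LGraph G (code_label D)).
Proof.
move=> uw allw aw; have sl : size ls = size ws by rewrite size_map.
have ltw (i : 'I_(size ls)) : i < size ws by rewrite -sl.
pose f (i : 'I_(size ls)) : G := nth v0 ws i.
have injf : injective f.
  move=> i j e; apply: val_inj; apply/eqP.
  by rewrite -(nth_uniq v0 (ltw i) (ltw j) uw) -/(f i) e.
exists f; split.
- apply: inj_card_bij injf _; rewrite card_ord sl -(card_uniqP uw).
  by apply: subset_leq_card; apply/subsetP => x _; apply: allw.
- by move=> i j; rewrite /f aw.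
- by move=> i /=; rewrite (nth_map v0).
Qed.

Lemma not_succ_succ m n : m = n.+1 -> n = m.+1 -> False.
Proof. lia. Qed.

Lemma leaf_code_family (G : sgraph) (D : {set G}) : is_tree G -> 2 < #|G| ->
  leaf_code D -> family_F (LGraph (code_label D)).
Proof.
have [n] := ubnP #|G|; elim: n G D => // n IHn G D; rewrite ltnS => leG tG G2 cD.
have [/card_gt0P[a _] conG _] := tG.
have [r rD _] := dominating_cnb a (code_dominating cD).
have [p [h ph]] := tree_rooted r tG.
have sub_closed (S : {set G}) : (forall u v : G, u \in S -> adj u v -> v \in S) ->
    forall u v : G, u \in S -> v \in S.
  move=> Sc u v uS; have clS : closed (@adj G) S.
    by apply: (intro_closed (sym_connect_sym (@adj_sym G))) => a' b ab /Sc/(_ ab).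
  by rewrite -(closed_connect clS (conG u v)).
case: (@arg_maxnP _ r predT h isT) => z _ zmax.
have {}zmax u : h u <= h z by apply: zmax.
have deep u v : h u = h z -> adj u v -> u != r /\ p u = v.
  move=> hu /(rooted_edge ph)[[]//|[_ _ hv]].
  by have := zmax v; rewrite hv hu ltnn.
have inD u v : h u = h z -> adj u v -> u \in D.
  move=> hu uv; apply: contraT => uD.
  have [c cD' uc] := code_dom cD uD; have [b bD ub] := code_free cD uD.
  have [_ e1] := deep _ _ hu uc; have [_ e2] := deep _ _ hu ub.
  by rewrite -e2 e1 cD' in bD.
have [y zy] := tree_nbr tG z (ltnW G2).
have [zr pz] := deep z y erefl zy.
have hz : h z = (h y).+1 by have [_ ->] := rooted_parent ph zr; rewrite pz.
have zD := inD z y erefl zy.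
have yD : y \notin D by apply/negP => yD; rewrite (code_indep cD) in zy.
have zN u : adj z u = (u == y).
  apply/idP/eqP => [zu|->//]; by have [_ <-] := deep z u erefl zu.
have yr : y != r by apply: contraNneq yD => ->.
have [] := rooted_parent ph yr; set x := p y => yx hy.
have yN u : adj y u = (u == x) || (u == z).
  apply/idP/orP => [yu|[] /eqP -> //]; last by rewrite adj_sym.
  case: (rooted_edge ph yu) => -[_]; first by left; apply/eqP.
  move=> pu hu; right; apply/eqP.
  have uD : u \in D by apply: (inD u y); rewrite 1?adj_sym // hu hz.
  by apply: (code_inj cD uD zD yu); rewrite adj_sym.
have xD : x \notin D.
  apply/negP => xD; have e := code_inj cD xD zD yx (_ : adj y z).
  by have := e; rewrite adj_sym zy => /(_ isT) e'; apply: (not_succ_succ hz); rewrite hy e'.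
have xr : x != r by apply: contraNneq xD => ->.
have yz : y != z by apply: contraNneq yD => ->.
have xy : x != y by rewrite eq_sym adj_neq.
have xz : x != z by apply: contraNneq xD => ->.
have lx : code_label D x = LB by rewrite /code_label (negbTE xD).
have ly : code_label D y = LB by rewrite /code_label (negbTE yD).
have lz : code_label D z = LA by rewrite /code_label zD.
have [v vD xv] := code_dom cD xD.
have vy : v != y by apply: contraNneq yD => <-.
have vx : v != x by rewrite eq_sym adj_neq.
have vz : v != z.
  by apply: contraTneq xv => ->; rewrite adj_sym zN.
have [/existsP[b /and3P[bD bny xb]]|none] :=
  boolP [exists b, [&& b \notin D, b != y & adj x b]].
  pose ws := [:: y; z]; pose S := [set u | u \notin ws].
  have inS u : (u \in S) = (u != y) && (u != z) by rewrite !inE negb_or.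
  have xS : x \in S by rewrite inS xy.
  have bz : b != z by apply: contraNneq bD => ->.
  have vS : v \in S by rewrite inS vy.
  have bS : b \in S by rewrite inS bny.
  have only_x s t : s \in S -> t \notin S -> adj s t -> s = x.
    rewrite inS => /andP[sy sz]; rewrite inS negb_and !negbK.
    move=> /orP[] /eqP ->; rewrite adj_sym ?zN ?yN ?(negbTE sy) // (negbTE sz) orbF.
    by move/eqP.
  have cS : leaf_code (code_in S D).
    apply: (induced_code cD only_x); right; exists v, b.
    by rewrite in_setI in_setD vD vS bS bD.
  have pS u : u \in S -> u != r -> p u \in S.
    rewrite inS => /andP[uy uz] ur; have [up hu] := rooted_parent ph ur.
    rewrite inS; apply/andP; split; apply/eqP => e.
      rewrite e adj_sym yN (negbTE uz) orbF in up; move/eqP: up => up.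
      by apply: (not_succ_succ hy); rewrite -up hu e.
    by rewrite e adj_sym zN (negbTE uy) in up.
  have rS : r \in S by rewrite inS !(eq_sym r) yr.
  have tS := induced_tree ph rS pS.
  have cardS : #|induced S| = #|S| by rewrite card_sig.
  have S3 : 2 < #|induced S|.
    rewrite cardS; apply: (@leq_trans #|x |: [set v; b]|).
      rewrite cardsU1 cards2 !inE negb_or eq_sym vx adj_neq //.
      by have -> : v != b by apply: contraNneq bD => <-.
    by apply/subset_leq_card/subsetP => u /setU1P[->|/set2P[] ->].
  have leS : #|induced S| < n.
    rewrite cardS; apply: leq_trans leG; rewrite -cardsT.
    by apply: proper_card; apply/properP; split=> //; exists y; rewrite // inS eqxx.
  have IH := IHn _ _ leS tS S3 cS.
  pose q : induced S := exist (fun u => u \in S) x xS.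
  have lis := @attach_liso G D S ws z q _ erefl _ _.
  apply: F_iso (lis _ _ _) _.
  - by rewrite /= inE yz.
  - move=> [|[|[|//]]] [|[|[|//]]] //= _ _; rewrite ?adj_irrefl //.
    by rewrite adj_sym.
  - move=> u [|[|//]] uS _ /=; rewrite adj_sym ?yN ?zN.
      by move: uS; rewrite inS => /andP[_ /negbTE ->]; rewrite orbF andbT.
    by move: uS; rewrite inS => /andP[/negbTE ->]; rewrite andbF.
  rewrite /= ly lz; apply: F_B IH _.
  by rewrite /= /code_label inE (negbTE xD).
have xN u : adj x u = (u == v) || (u == y).
  apply/idP/orP => [xu|[] /eqP -> //]; last by rewrite adj_sym.
  have [uD|uD] := boolP (u \in D).
    by left; apply/eqP; apply: (code_inj cD uD vD xu xv).
  right; move/existsPn: none => /(_ u).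
  by rewrite uD xu andbT negbK.
have px : p x = v.
  have [xp hx] := rooted_parent ph xr.
  move: (xp); rewrite xN => /orP[] /eqP // e.
  by case: (not_succ_succ hy); rewrite hx e.
have hx : h x = (h v).+1 by have [_ ->] := rooted_parent ph xr; rewrite px.
have [/existsP[u /andP[ux vu]]|none2] := boolP [exists u, (u != x) && adj v u].
  pose ws := [:: x; y; z]; pose S := [set u | u \notin ws].
  have inS w : (w \in S) = [&& w != x, w != y & w != z] by rewrite !inE !negb_or.
  have vS : v \in S by rewrite inS vx vy.
  have only_v s t : s \in S -> t \notin S -> adj s t -> s = v.
    rewrite inS => /and3P[/negbTE sx /negbTE sy /negbTE sz]; rewrite inS !negb_and !negbK.
    move=> /or3P[] /eqP ->; rewrite adj_sym ?xN ?yN ?zN ?sx ?sy ?sz //.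
    by rewrite orbF => /eqP.
  have cS : leaf_code (code_in S D).
    by apply: (induced_code cD only_v); left.
  have pS w : w \in S -> w != r -> p w \in S.
    move=> wS wr; have [wp hw] := rooted_parent ph wr.
    apply: contraT => pwS; have e := only_v _ _ wS pwS wp; subst w.
    move: (wS) pwS wp; rewrite !inS !negb_and !negbK => /and3P[vx' vy' vz'].
    move=> /or3P[] /eqP e; rewrite e adj_sym ?yN ?zN ?(negbTE vx') ?(negbTE vy') ?(negbTE vz') //.
    by case: (not_succ_succ hx); rewrite hw e.
  have rS : r \in S.
    by rewrite inS !(eq_sym r) xr yr.
  have tS := induced_tree ph rS pS.
  have uD : u \notin D by apply/negP => uD; rewrite (code_indep cD) in vu.
  have uy : u != y.
    by apply: contraTneq vu => ->; rewrite adj_sym yN (negbTE vx) (negbTE vz).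
  have uz : u != z by apply: contraNneq uD => ->.
  have uS : u \in S by rewrite inS ux uy.
  have [t tD ut] := code_free cD uD.
  have tS' : t \in S.
    apply: contraT => tS'; have e := only_v _ _ uS tS' ut.
    by rewrite e vD in uD.
  have cardS : #|induced S| = #|S| by rewrite card_sig.
  have S3 : 2 < #|induced S|.
    rewrite cardS; apply: (@leq_trans #|u |: [set v; t]|).
      rewrite cardsU1 cards2 !inE negb_or (adj_neq ut) eq_sym (adj_neq vu).
      by have -> : v != t by apply: contraNneq tD => <-.
    by apply/subset_leq_card/subsetP => w /setU1P[->|/set2P[] ->].
  have leS : #|induced S| < n.
    rewrite cardS; apply: leq_trans leG; rewrite -cardsT.
    by apply: proper_card; apply/properP; split=> //; exists y; rewrite // inS eqxx andbF.
  have IH := IHn _ _ leS tS S3 cS.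
  pose q : induced S := exist (fun u => u \in S) v vS.
  have lis := @attach_liso G D S ws z q _ erefl _ _.
  apply: F_iso (lis _ _ _) _.
  - by rewrite /= !inE negb_or xy xz yz.
  - move=> i j; move: i j => [|[|[|//]]] [|[|[|//]]] //= _ _;
      rewrite ?adj_irrefl ?xN ?yN ?zN ?eqxx ?orbT //.
    + by rewrite !(eq_sym z) (negbTE vz) (negbTE yz).
    + by rewrite (negbTE xy).
  - move=> w [|[|[|//]]] wS _ /=; move: wS; rewrite inS adj_sym ?xN ?yN ?zN;
      move=> /and3P[/negbTE n1 /negbTE n2 /negbTE n3]; by rewrite ?n1 ?n2 ?n3 ?orbF ?andbT ?andbF.
  rewrite /= lx ly lz; apply: F_A IH _.
  by rewrite /= /code_label inE vD.
have vN u : adj v u = (u == x).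
  apply/idP/eqP => [vu|->]; last by rewrite adj_sym.
  by move/existsPn: none2 => /(_ u); rewrite vu andbT negbK => /eqP.
have all4 u : u \in [:: v; x; y; z].
  have := sub_closed [set u in [:: v; x; y; z]] _ v u; rewrite !in_set; apply.
    move=> s t; rewrite !inE => /or4P[] /eqP ->; rewrite ?vN ?xN ?yN ?zN //.
    - by move=> ->; rewrite /= ?orbT.
    - by move=> /orP[] ->; rewrite /= ?orbT.
    - by move=> /orP[] ->; rewrite /= ?orbT.
    - by move=> ->; rewrite /= ?orbT.
  by rewrite inE eqxx.
apply: F_iso (@path_liso G D [:: v; x; y; z] v _ all4 _) _.
- by rewrite /= !inE !negb_or vx vy vz xy xz yz.
- move=> i j; move: i j => [|[|[|[|//]]]] [|[|[|[|//]]]] //= _ _;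
    rewrite ?vN ?xN ?yN ?zN ?eqxx ?orbT //;
  by rewrite ?[x == v]eq_sym ?[z == _]eq_sym ?[y == x]eq_sym ?(negbTE vx)
    ?(negbTE vy) ?(negbTE vz) ?(negbTE xy) ?(negbTE xz) ?(negbTE yz).
- have -> : [seq code_label D u | u <- [:: v; x; y; z]] = [:: LA; LB; LB; LA].
    by rewrite /= lx ly lz /code_label vD.
  exact: F_P4.
Qed.


Definition externals (G : sgraph) (P : nbhd_family G) : {set general_corona P} :=
  [set x | if x is inl _ then true else false].

Lemma corona_code (G : sgraph) (P : nbhd_family G) :
  vertex_nbhd_partition P -> leaf_code (externals P).
Proof.
move=> /forallP partP; set D := externals P.
have inD v : (inl v : general_corona P) \in D by rewrite inE.
have ninD q : (inr q : general_corona P) \notin D by rewrite inE.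
split.
- by move=> [x|x] [y|y]; rewrite !inE.
- move=> [v|q] [x|x] [y|y]; rewrite !inE //=.
  by move=> _ _ /eqP -> /eqP ->.
- move=> [v|q]; first by rewrite inD.
  by exists (inl (val q).1) => /=.
- move=> [v|[[v A] /= AP]]; first by rewrite inD.
  have /and3P[/eqP cP tP nP] := partP v.
  have [e|[u uA]] := set_0Vmem A; first by case/negP: nP; rewrite -e.
  have vu : adj v u.
    have : u \in cover (P v) by apply/bigcupP; exists A.
    by rewrite cP inE.
  have /and3P[/eqP cPu _ _] := partP u.
  have /bigcupP[B BP vB] : v \in cover (P u) by rewrite cPu inE adj_sym.
  have uBP : (u, B).2 \in P (u, B).1 by [].
  exists (inr (exist (fun p : G * {set G} => p.2 \in P p.1) (u, B) uBP)) => //=.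
  by rewrite vu uA vB.
Qed.

(** * General coronas *)

Section CodeCorona.
Variables (G : sgraph) (D : {set G}).
Hypotheses (tG : is_tree G) (cD : leaf_code D).

Notation V := {x : G | x \in D}.

Lemma code_center : exists c : G -> V, forall v, cnb v (val (c v)).
Proof.
have /fin_all_exists[c cP] v : exists c : V, cnb v (val c).
  have [c cD' vc] := dominating_cnb v (code_dominating cD).
  by exists (exist (fun x => x \in D) c cD').
by exists c.
Qed.

Variable c : G -> V.
Hypothesis cP : forall v, cnb v (val (c v)).

Lemma center_val (x : V) : c (val x) = x.
Proof.
apply: val_inj; apply: (code_packing cD (valP _) (valP x) (cP _)).
by rewrite /cnb eqxx.
Qed.

Lemma center_adj v (x : V) : adj v (val x) -> c v = x.
Proof.
move=> vx; apply: val_inj; apply: (code_packing cD (valP _) (valP x) (cP v)).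
by rewrite /cnb vx orbT.
Qed.

Lemma adj_center v : v \notin D -> adj v (val (c v)).
Proof. by move=> vD; case/orP: (cP v) => [/eqP e|//]; rewrite e (valP (c v)) in vD. Qed.

Definition quotient_adj : rel V := fun x y =>
  (x != y) && [exists a, exists b, [&& adj a b, c a == x & c b == y]].

Lemma quotient_adjP (x y : V) :
  reflect (x != y /\ exists a b, [/\ adj a b, c a = x & c b = y]) (quotient_adj x y).
Proof.
apply: (iffP andP) => -[xy].
  case/existsP=> a /existsP[b /and3P[ab /eqP ax /eqP bY]].
  by split=> //; exists a, b.
move=> [a [b [ab ax bY]]]; split=> //.
by apply/existsP; exists a; apply/existsP; exists b; rewrite ab ax bY !eqxx.
Qed.

Lemma quotient_sym : symmetric quotient_adj.
Proof.
by move=> x y; apply/quotient_adjP/quotient_adjP => -[xy [a [b [ab ax bY]]]];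
  split; rewrite 1?eq_sym //; exists b, a; rewrite adj_sym.
Qed.

Lemma quotient_irrefl : irreflexive quotient_adj.
Proof. by move=> x; rewrite /quotient_adj eqxx. Qed.

Definition quotient := SGraph quotient_sym quotient_irrefl.

Lemma edge_notin a b : adj a b -> c a != c b -> a \notin D.
Proof.
move=> ab; apply: contra => aD.
have -> : c a = exist (fun x => x \in D) a aD.
  by rewrite -[RHS]center_val.
by rewrite eq_sym; apply/eqP/center_adj; rewrite adj_sym.
Qed.

Section Root.
Variables (r : G) (p : G -> G) (h : G -> nat).
Hypothesis ph : towards [set r] p h.

Lemma quotient_up a b : adj a b -> c a != c b -> p a = b -> h a = (h b).+1 ->
  [/\ p (val (c a)) = a, h (val (c a)) = (h a).+1 & val (c a) != r].
Proof.
move=> ab cab pab hab; have aD := edge_notin ab cab.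
have bD : b \notin D by apply: (@edge_notin b a); rewrite 1?adj_sym // eq_sym.
case: (rooted_edge ph (adj_center aD)) => -[] // _ e _.
by rewrite -pab e (valP (c a)) in bD.
Qed.

Lemma quotient_tree : r \in D -> is_tree quotient.
Proof.
move=> rD.
pose r' : quotient := exist (fun x => x \in D) r rD.
pose p' (x : quotient) : quotient := c (p (p (val x))).
pose h' (x : quotient) := h (val x).
have up (x : quotient) : x != r' -> adj x (p' x) /\ h (val (p' x)) < h (val x).
  move=> xr; have xr0 : val x != r by [].
  have [xa hx] := rooted_parent ph xr0; set a := p (val x) in xa hx.
  have aD : a \notin D.
    by apply/negP => aD; rewrite (code_indep cD (valP x) aD) in xa.
  have ar : a != r by apply: contraNneq aD => ->.
  have [ab ha] := rooted_parent ph ar; rewrite -/(p' x); set b := p a in ab ha.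
  have ca : c a = x by apply: center_adj; rewrite adj_sym.
  have bD : b \notin D.
    apply/negP => bD; have e := code_inj cD bD (valP x) ab (_ : adj a (val x)).
    by rewrite adj_sym in e; move: (e xa) hx ha => ->; lia.
  have hb : h (val (c b)) <= (h b).+1.
    by case: (rooted_edge ph (adj_center bD)) => -[_ _]; lia.
  have lt : h (val (c b)) < h (val x) by lia.
  split=> //; apply/quotient_adjP; split.
    by apply: contraTneq lt => e; rewrite -[c b]/(p' x) -e ltnn.
  by exists a, b.
apply: (@rooted_tree _ r' p' h') => [x /up[]//|x /up[]//|x y].
move=> /quotient_adjP[xy [a [b [ab ca cb]]]].
have cab : c a != c b by rewrite ca cb.
case: (rooted_edge ph ab) => -[_ pab hab].
  have [px _ xr] := quotient_up ab cab pab hab.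
  by left; rewrite -ca; split=> //; rewrite /p' px pab cb.
have [py _ yr] : [/\ p (val (c b)) = b, h (val (c b)) = (h b).+1 & val (c b) != r].
  by apply: (@quotient_up b a); rewrite // 1?adj_sym // eq_sym.
by right; rewrite -cb; split=> //; rewrite /p' py pab ca.
Qed.

Lemma quotient_edge_inj a b a' b' : adj a b -> adj a' b' -> c a != c b ->
  c a = c a' -> c b = c b' -> a = a'.
Proof.
move=> ab ab' cab ca cb; have cab' : c a' != c b' by rewrite -ca -cb.
have le z w : adj z w -> c z != c w -> h (val (c z)) <= (h z).+1.
  move=> zw czw; have := adj_center (edge_notin zw czw).
  by case/(rooted_edge ph) => -[_ _ ->]; rewrite ?leqnn // !leqW.
have up x y : adj x y -> c x != c y ->
    p (val (c x)) = x /\ h (val (c y)) < h (val (c x)) \/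
    p (p (val (c y))) = x /\ h (val (c x)) < h (val (c y)).
  move=> xy cxy; have yx : adj y x by rewrite adj_sym.
  have cyx : c y != c x by rewrite eq_sym.
  case: (rooted_edge ph xy) => -[_ pxy hxy].
    have [px hx _] := quotient_up xy cxy pxy hxy.
    by left; split=> //; rewrite hx hxy ltnS (le y x).
  have [px hx _] := quotient_up yx cyx pxy hxy.
  by right; rewrite px; split=> //; rewrite hx hxy ltnS (le x y).
have := up _ _ ab' cab'; rewrite -ca -cb.
case: (up _ _ ab cab) => -[e lt] [] [e' lt'].
- by rewrite -e e'.
- by have := ltn_trans lt lt'; rewrite ltnn.
- by have := ltn_trans lt lt'; rewrite ltnn.
- by rewrite -e e'.
Qed.

Lemma quotient_loop a b : adj a b -> a \notin D -> b \notin D -> c a != c b.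
Proof.
move=> ab aD bD; apply/negP => /eqP cab.
have ac := adj_center aD; have bc := adj_center bD; rewrite -cab in bc.
exact: (tree_triangle tG ab bc ac).
Qed.

(* The part of the neighbourhood of [c a] that the internal vertex [a] stands for. *)
Definition branch a : {set quotient} :=
  [set y | (y != c a) && [exists b, adj a b && (c b == y)]].

Lemma branchP a (y : quotient) :
  reflect (y != c a /\ exists2 b, adj a b & c b = y) (y \in branch a).
Proof.
rewrite inE; apply: (iffP andP) => -[ya].
  by move=> /existsP[b /andP[ab /eqP cb]]; split=> //; exists b.
by move=> [b ab cb]; split=> //; apply/existsP; exists b; rewrite ab cb eqxx.
Qed.

Definition branches : nbhd_family quotient :=
  [ffun x : quotient => [set branch a | a in [set a | adj (val x) a]]].

Lemma branches_inP (x : quotient) A :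
  reflect (exists2 a, adj (val x) a & A = branch a) (A \in branches x).
Proof.
rewrite ffunE; apply: (iffP imsetP) => -[a]; first by rewrite inE; exists a.
by move=> xa ->; exists a; rewrite ?inE.
Qed.

Lemma adj_center_notin (x : quotient) a : adj (val x) a -> a \notin D /\ c a = x.
Proof.
move=> xa; split; last by apply: center_adj; rewrite adj_sym.
by apply/negP => aD; rewrite (code_indep cD (valP x) aD) in xa.
Qed.

Lemma branch_nonempty a : a \notin D -> branch a != set0.
Proof.
move=> aD; have [b bD ab] := code_free cD aD; apply/set0Pn; exists (c b).
by apply/branchP; split; [rewrite eq_sym quotient_loop|exists b].
Qed.

Lemma branch_inj (x y : quotient) a a' : adj (val x) a -> adj (val x) a' ->
  y \in branch a -> y \in branch a' -> a = a'.
Proof.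
move=> /adj_center_notin[_ ca] /adj_center_notin[_ ca'].
move=> /branchP[ya [b ab cb]] /branchP[ya' [b' ab' cb']].
by apply: (quotient_edge_inj ab ab'); rewrite ?ca ?ca' ?cb ?cb' // -ca eq_sym.
Qed.

Lemma branches_partition : vertex_nbhd_partition branches.
Proof.
apply/forallP => x; apply/and3P; split.
- apply/eqP/setP => y; rewrite inE; apply/bigcupP/idP.
    move=> [_ /branches_inP[a xa ->]] /branchP[ya [b ab cb]].
    have [_ ca] := adj_center_notin xa.
    by apply/quotient_adjP; split; [rewrite -ca eq_sym|exists a, b].
  move=> /quotient_adjP[xy [a [b [ab ca cb]]]].
  have xa : adj (val x) a.
    have aD : a \notin D by apply: (edge_notin ab); rewrite ca cb.
    by rewrite adj_sym -ca; apply: adj_center.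
  exists (branch a); first by apply/branches_inP; exists a.
  by apply/branchP; split; [rewrite ca eq_sym|exists b].
- apply/trivIsetP => _ _ /branches_inP[a xa ->] /branches_inP[a' xa' ->] ne.
  rewrite -setI_eq0; apply: contraNT ne => /set0Pn[y /setIP[ya ya']].
  by rewrite (branch_inj xa xa' ya ya').
- apply/negP => /branches_inP[a /adj_center_notin[aD _] e].
  by have := branch_nonempty aD; rewrite -e eqxx.
Qed.

Definition corona_vertex v (w : general_corona branches) : Prop :=
  match w with
  | inl x => val x = v
  | inr q => v \notin D /\ val q = (c v, branch v)
  end.

Lemma quotient_corona : giso G (general_corona branches).
Proof.
have bin v : v \notin D -> branch v \in branches (c v).
  by move=> vD; apply/branches_inP; exists v; rewrite // adj_sym adj_center.
have /fin_all_exists[f fP] v : exists w, corona_vertex v w.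
  have [vD|vD] := boolP (v \in D).
    by exists (inl (exist (fun x => x \in D) v vD)).
  by exists (inr (exist (fun q : quotient * {set quotient} => q.2 \in branches q.1)
                        (c v, branch v) (bin v vD))).
have /fin_all_exists[g gP] w : exists v, corona_vertex v w.
  case: w => [x|[[x A] /= xA]]; first by exists (val x).
  have /branches_inP[a xa eA] := xA; have [aD ca] := adj_center_notin xa.
  by exists a; rewrite ca eA.
have inj_r v w w' : corona_vertex v w -> corona_vertex v w' -> w = w'.
  case: w w' => [x|q] [x'|q'] /=.
  - by move=> e e'; congr inl; apply: val_inj; rewrite /= e.
  - by move=> <- [/negP[]]; apply: valP.
  - by move=> [/negP nD _] e; case: nD; rewrite -e; apply: valP.
  - by move=> [_ e] [_ e']; congr inr; apply: val_inj; rewrite /= e.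
have inj_l v v' w : corona_vertex v w -> corona_vertex v' w -> v = v'.
  case: w => [x <-//|q] /= [vD ->] [vD' [ecv ebv]].
  have [y yv] := set0Pn _ (branch_nonempty vD).
  apply: (@branch_inj (c v) y); rewrite -?ebv // adj_sym.
    exact: adj_center.
  by rewrite ecv; apply: adj_center.
exists f.
  exists g => [v|w]; first by apply: inj_l (fP v).
  exact: inj_r (gP w).
move=> v v'; have := fP v'; have := fP v.
case: (f v) (f v') => [x|q] [x'|q'] /=.
- by move=> <- <-; rewrite (code_indep cD (valP x) (valP x')).
- move=> <- [vD' ->] /=; rewrite adj_sym.
  by apply/eqP/idP => [<-|/center_adj//]; apply: adj_center.
- move=> [vD ->] <- /=.
  by apply/eqP/idP => [<-|/center_adj//]; apply: adj_center.
move=> [vD ->] [vD' ->] /=; apply/and3P/idP.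
  move=> [_ /branchP[cv' [b vb cb]] /branchP[cv [a va ca]]].
  suff -> : v = a by rewrite adj_sym.
  by apply: (quotient_edge_inj vb (_ : adj a v')); rewrite 1?adj_sym // cb 1?eq_sym.
move=> vv'; have ne := quotient_loop vv' vD vD'; split.
- by apply/quotient_adjP; split=> //; exists v, v'.
- by apply/branchP; split; [rewrite eq_sym|exists v'].
- by apply/branchP; split; [|exists v; rewrite // adj_sym].
Qed.

End Root.
End CodeCorona.

Lemma leaf_code_corona (G : sgraph) (D : {set G}) : is_tree G -> leaf_code D ->
  exists (T' : sgraph) (P : nbhd_family T'),
    [/\ is_tree T', vertex_nbhd_partition P & giso G (general_corona P)].
Proof.
move=> tG cD; have [/card_gt0P[a _] _ _] := tG.
have [r rD _] := dominating_cnb a (code_dominating cD).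
have [p [h ph]] := tree_rooted r tG; have [c cP] := code_center cD.
exists (quotient c), (branches c); split.
- exact: (quotient_tree cD cP ph rD).
- exact: (branches_partition tG cD cP ph).
- exact: (quotient_corona tG cD cP ph).
Qed.


Lemma disjoint_setUr (T : finType) (A B C : {set T}) :
  [disjoint A & B :|: C] = [disjoint A & B] && [disjoint A & C].
Proof. by rewrite -!setI_eq0 setIUr setU_eq0. Qed.

(** * Contractions and splittings of neighbourhood partitions *)

Section Families.
Variable G : sgraph.
Implicit Types (P Q : nbhd_family G) (v : G) (A B : {set G}).

Lemma contract_familyE P v A B x : contract_family P v A B x =
  if x == v then (A :|: B) |: (P v :\: [set A; B]) else P x.
Proof. by rewrite ffunE. Qed.

Lemma contract_partition P v A B : vertex_nbhd_partition P ->
  A \in P v -> B \in P v -> vertex_nbhd_partition (contract_family P v A B).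
Proof.
move=> /forallP partP AP BP; apply/forallP => x; rewrite contract_familyE.
case: eqP => [->|_]; last exact: partP.
have /and3P[/eqP cP tP nP] := partP v.
have PN C : C \in P v -> C != set0 by move=> CP; apply: contraNneq nP => <-.
apply/and3P; split.
- rewrite -cP; apply/eqP/setP => y; apply/bigcupP/bigcupP => -[C].
    move=> /setU1P[->|/setDP[CP _] yC]; last by exists C.
    by case/setUP => y_; [exists A|exists B].
  move=> CP yC; have [/set2P CAB|nC] := boolP (C \in [set A; B]).
    exists (A :|: B); first by rewrite setU11.
    by rewrite inE; case: CAB yC => -> ->; rewrite ?orbT.
  by exists C => //; apply/setU1P; right; apply/setDP.
- have disj C : C \in P v :\: [set A; B] -> [disjoint C & A :|: B].
    move=> /setDP[CP]; rewrite !inE negb_or => /andP[CA CB].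
    by rewrite disjoint_setUr !(trivIsetP tP).
  apply/trivIsetP => C1 C2 /setU1P[->|C1P] /setU1P[->|C2P] ne.
  + by rewrite eqxx in ne.
  + by rewrite disjoint_sym disj.
  + exact: disj.
  + by move: C1P C2P => /setDP[C1P _] /setDP[C2P _]; apply: (trivIsetP tP).
- apply/negP => /setU1P[e|/setDP[]]; last by rewrite (negbTE nP).
  have /set0Pn[y yA] := PN _ AP.
  by have := in_set0 y; rewrite e inE yA.
Qed.

Lemma internal_contraction_partition P Q :
  internal_contraction P Q -> vertex_nbhd_partition P /\ vertex_nbhd_partition Q.
Proof.
move=> /andP[partP /existsP[v /exists_inP[A AP /exists_inP[B BP]]]] /andP[_ /eqP ->].
by split=> //; apply: contract_partition.
Qed.

Lemma finest_partition : vertex_nbhd_partition (finest_family G).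
Proof.
apply/forallP => v; rewrite ffunE; apply/and3P; split.
- apply/eqP/setP => x; apply/bigcupP/idP => [[_ /imsetP[u uN ->]] /set1P -> //|xN].
  by exists [set x]; rewrite ?set11 // imset_f.
- apply/trivIsetP => _ _ /imsetP[u _ ->] /imsetP[w _ ->] ne.
  by rewrite disjoints1 inE; apply: contraNneq ne => ->.
- by apply/imsetP => -[u _ e]; have := set11 u; rewrite -e inE.
Qed.

Lemma coarsest_partition : (forall v, nbhd v != set0) ->
  vertex_nbhd_partition (coarsest_family G).
Proof.
move=> ne; apply/forallP => v; rewrite ffunE; apply/and3P; split.
- by rewrite /cover big_set1.
- by apply/trivIsetP => A B /set1P -> /set1P ->; rewrite eqxx.
- by rewrite inE eq_sym.
Qed.

Lemma connect_contraction_partition Q :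
  connect (@internal_contraction G) (finest_family G) Q -> vertex_nbhd_partition Q.
Proof.
move=> /connectP[s ps ->]; elim: s (finest_family G) finest_partition ps => //= P s IHs Q0 _.
by move=> /andP[/internal_contraction_partition[_ partP] /IHs]; apply.
Qed.

Lemma connect_splitting_partition Q : (forall v, nbhd v != set0) ->
  connect (@internal_splitting G) (coarsest_family G) Q -> vertex_nbhd_partition Q.
Proof.
move=> ne /connectP[s ps ->].
elim: s (coarsest_family G) (coarsest_partition ne) ps => //= P s IHs Q0 _.
by move=> /andP[/internal_contraction_partition[partP _] /IHs]; apply.
Qed.

Lemma contractionI P v A B : vertex_nbhd_partition P -> A \in P v -> B \in P v ->
  A != B -> internal_contraction P (contract_family P v A B).
Proof.
move=> partP AP BP AB; rewrite /internal_contraction partP.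
apply/existsP; exists v; apply/exists_inP; exists A => //.
by apply/exists_inP; exists B; rewrite ?AB /=.
Qed.

Lemma contract_card P v A B : A \in P v -> B \in P v -> A != B ->
  \sum_x #|contract_family P v A B x| < \sum_x #|P x|.
Proof.
move=> AP BP AB; rewrite (bigD1 v) // [X in _ < X](bigD1 v) //=.
rewrite -addSn leq_add //; last first.
  by apply: leq_sum => x /negbTE xv; rewrite contract_familyE xv.
rewrite contract_familyE eqxx cardsU1.
have := cardsID [set A; B] (P v).
rewrite (setIidPr _); last by apply/subsetP => C /set2P[] ->.
rewrite cards2 AB; move=> <-.
by rewrite addSn ltnS leq_add // leq_b1.
Qed.

Lemma coarsest_connect P : (forall v, nbhd v != set0) -> vertex_nbhd_partition P ->
  connect (@internal_splitting G) (coarsest_family G) P.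
Proof.
move=> ne; have [n] := ubnP (\sum_x #|P x|); elim: n P => // n IHn P ltP partP.
have [/existsP[v /exists_inP[A AP /exists_inP[B BP AB]]]|none] :=
  boolP [exists v, exists A in P v, exists B in P v, A != B].
  apply: (@connect_trans _ _ (contract_family P v A B)).
    apply: IHn; last exact: contract_partition.
    by apply: leq_trans (contract_card AP BP AB) _.
  by apply: connect1; apply: contractionI.
suff -> : P = coarsest_family G by [].
apply/ffunP => v; rewrite ffunE.
have /forallP/(_ v)/and3P[/eqP cP _ _] := partP.
have /set0Pn[u] := ne v; rewrite -cP => /bigcupP[A AP uA].
have eA B : B \in P v -> B = A.
  move=> BP; apply/eqP; apply: contraNT none => BA.
  apply/existsP; exists v; apply/exists_inP; exists B => //.
  by apply/exists_inP; exists A.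
have eP : P v = [set A].
  by apply/setP => B; rewrite inE; apply/idP/eqP => [/eA|->].
by move: cP; rewrite eP /cover big_set1 => ->.
Qed.

Definition split_family P v A B : nbhd_family G :=
  [ffun x => if x == v then A |: (B |: (P v :\ (A :|: B))) else P x].

Lemma split_contract P v A B : vertex_nbhd_partition P -> A :|: B \in P v ->
  A != set0 -> B != set0 -> [disjoint A & B] ->
  [/\ vertex_nbhd_partition (split_family P v A B), A != B,
      contract_family (split_family P v A B) v A B = P
    & \sum_x #|P x| < \sum_x #|split_family P v A B x|].
Proof.
move=> partP ABP A0 B0 dAB.
have AB : A != B.
  apply: contraNneq A0 => e; move: dAB; rewrite -e -setI_eq0 setIid; exact.
have /and3P[/eqP cP tP nP] := (forallP partP) v.
have disjP (C : {set G}) : C \in P v -> C != A :|: B -> [disjoint C & A] /\ [disjoint C & B].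
  move=> CP ne; have := trivIsetP tP _ _ CP ABP ne.
  by rewrite disjoint_setUr => /andP[].
have self (C : {set G}) : [disjoint C & C] -> C = set0.
  by rewrite -setI_eq0 setIid => /eqP.
have notinP (C : {set G}) : C != set0 -> C \subset A :|: B -> C != A :|: B -> C \notin P v.
  move=> C0 Csub ne; apply: contra C0 => CP; apply/eqP.
  have := trivIsetP tP _ _ CP ABP ne; rewrite -setI_eq0.
  by rewrite (setIidPl Csub) => /eqP.
have AnU : A != A :|: B.
  apply: contraNneq B0 => e; apply/eqP/self.
  by apply: disjointWl dAB; rewrite e subsetUr.
have BnU : B != A :|: B.
  apply: contraNneq A0 => e; apply/eqP/self; rewrite disjoint_sym in dAB.
  by apply: disjointWl dAB; rewrite e subsetUl.
have AnP : A \notin P v by apply: notinP; rewrite ?subsetUl.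
have BnP : B \notin P v by apply: notinP; rewrite ?subsetUr.
set Q := split_family P v A B.
have Qv : Q v = A |: (B |: (P v :\ (A :|: B))) by rewrite ffunE eqxx.
have AQ : A \in Q v by rewrite Qv setU11.
have BQ : B \in Q v by rewrite Qv !inE eqxx orbT.
have cQ : contract_family Q v A B = P.
  apply/ffunP => x; rewrite contract_familyE; case: eqP => [->|xv]; last first.
    by rewrite ffunE (introF eqP xv).
  apply/setP => C; rewrite Qv !inE.
  have [->|CU] /= := eqVneq C (A :|: B); first by rewrite ABP.
  have [->|CA] /= := eqVneq C A; first by rewrite (negbTE AnP).
  by have [->|CB] //= := eqVneq C B; rewrite (negbTE BnP).
split=> //; last by rewrite -{1}cQ; apply: contract_card.
apply/forallP => x; rewrite /Q ffunE; case: eqP => [->|_]; last exact: (forallP partP).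
have inPU C : C \in P v :\ (A :|: B) -> C \in P v /\ C != A :|: B by case/setD1P.
apply/and3P; split.
- rewrite -cP; apply/eqP/setP => y; apply/bigcupP/bigcupP => -[C].
    move=> /setU1P[-> yA|/setU1P[-> yB|/inPU[CP _] yC]]; last by exists C.
      by exists (A :|: B); rewrite // inE yA.
    by exists (A :|: B); rewrite // inE yB orbT.
  move=> CP; have [->|CU yC] := eqVneq C (A :|: B).
    case/setUP => y_; first by exists A; rewrite // setU11.
    by exists B; rewrite // !inE eqxx orbT.
  by exists C; rewrite // !inE CP CU !orbT.
- apply/trivIsetP => C1 C2.
  move=> /setU1P[->|/setU1P[->|/inPU[P1 U1]]] /setU1P[->|/setU1P[->|/inPU[P2 U2]]] ne;
    rewrite ?eqxx // in ne *.
  + by rewrite disjoint_sym; have [] := disjP _ P2 U2.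
  + by rewrite disjoint_sym.
  + by rewrite disjoint_sym; have [] := disjP _ P2 U2.
  + by have [] := disjP _ P1 U1.
  + by have [] := disjP _ P1 U1.
  + exact: (trivIsetP tP).
- by rewrite !inE !negb_or ![set0 == _]eq_sym A0 B0 (negbTE nP) andbF.
Qed.

Lemma finest_connect P : vertex_nbhd_partition P ->
  connect (@internal_contraction G) (finest_family G) P.
Proof.
pose m P := \sum_(x : G) (#|{set G}| - #|P x|).
have [n] := ubnP (m P); elim: n P => // n IHn P ltP partP.
have [/existsP[v /exists_inP[C CP C1]]|none] :=
  boolP [exists v, exists C in P v, 1 < #|C|].
  have [a aC] : exists a, a \in C by apply/card_gt0P; apply: ltnW.
  have eC : [set a] :|: (C :\ a) = C by rewrite setD1K.
  have D0 : C :\ a != set0 by rewrite -card_gt0; rewrite (cardsD1 a) aC in C1.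
  have s0 : [set a] != set0 by apply/set0Pn; exists a; rewrite set11.
  have dj : [disjoint [set a] & C :\ a] by rewrite disjoints1 !inE eqxx.
  have CP' : [set a] :|: (C :\ a) \in P v by rewrite eC.
  have [partQ AB cQ ltQ] := split_contract partP CP' s0 D0 dj.
  set Q := split_family P v [set a] (C :\ a) in partQ cQ ltQ.
  apply: (@connect_trans _ _ Q).
    apply: IHn partQ; apply: leq_trans (ltP : m P <= n).
    have sumE R : m R + \sum_x #|R x| = \sum_(x : G) #|{set G}|.
      rewrite -big_split; apply: eq_bigr => x _ /=.
      by rewrite subnK // -cardsT; apply/subset_leq_card/subsetP => A _; rewrite inE.
    by have := sumE Q; have := sumE P; lia.
  apply: connect1; rewrite -cQ; apply: contractionI => //.
    by rewrite ffunE eqxx setU11.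
  by rewrite ffunE eqxx !inE eqxx orbT.
suff -> : P = finest_family G by [].
have single v A : A \in P v -> exists2 u, u \in nbhd v & A = [set u].
  move=> AP; have /and3P[/eqP cP _ nP] := (forallP partP) v.
  have /set0Pn[u uA] : A != set0 by apply: contraNneq nP => <-.
  exists u; first by rewrite -cP; apply/bigcupP; exists A.
  apply/eqP; rewrite eq_sym eqEcard sub1set uA cards1 leqNgt.
  apply: contraNN none => A1; apply/existsP; exists v.
  by apply/exists_inP; exists A.
apply/ffunP => v; rewrite ffunE; apply/setP => A; apply/idP/imsetP => [/single//|].
move=> [u uN ->]; have /and3P[/eqP cP _ _] := (forallP partP) v.
have /bigcupP[B BP uB] : u \in cover (P v) by rewrite cP.
by have [w _ eB] := single v B BP; move: uB BP; rewrite eB => /set1P ->.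
Qed.

End Families.

Lemma giso_card (G H : sgraph) : giso G H -> #|G| = #|H|.
Proof. by case=> f /bij_eq_card. Qed.

Lemma corona_nbhd_nonempty (G : sgraph) (P : nbhd_family G) : is_tree G ->
  (forall v, #|P v| <= 1) \/ vertex_nbhd_partition P ->
  2 < #|general_corona P| -> forall v : G, nbhd v != set0.
Proof.
move=> tG hP cP v; apply: contraTneq cP => v0.
have G1 : #|G| <= 1.
  rewrite leqNgt; apply/negP => /(tree_nbr tG v)[u vu].
  by have := in_set0 u; rewrite -v0 inE vu.
have eG u : u = v.
  exact: (card_le1_eqP G1).
have Pv : #|P v| <= 1.
  case: hP => [//|/forallP/(_ v)]; rewrite v0 => /and3P[/eqP c0 _ n0].
  suff -> : P v = set0 by rewrite cards0.
  apply/setP => A; rewrite inE; apply/negP => AP.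
  case/negP: n0; suff <- : A = set0 by [].
  by apply/eqP; rewrite -subset0 -c0 bigcup_sup.
have Q1 : #|{: {p : G * {set G} | p.2 \in P p.1}}| <= 1.
  apply/card_le1_eqP => -[[x A] /= xA] [[y B] /= yB] _ _.
  apply: val_inj => /=; move: xA yB; rewrite (eG x) (eG y) => AP BP.
  by congr pair; apply: (card_le1_eqP Pv).
rewrite -leqNgt card_sum; exact: (leq_add G1 Q1).
Qed.

Theorem theorem2 (T : sgraph) (T_tree : is_tree T) (T_order : 2 < #|T|) :
  [<-> (* (1) *) sd_number_is T 3;
       (* (2) *) exists! D : {set T},
                   [/\ dominating D, two_packing D
                     & forall v : T, leaf v -> v \in D];
       (* (3) *) exists l : T -> label, family_F (LGraph l);
       (* (4) *) exists (T' : sgraph) (P : nbhd_family T'),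
                   [/\ is_tree T', vertex_nbhd_partition P
                     & giso T (general_corona P)];
       (* (5) *) exists (T' : sgraph) (P : nbhd_family T'),
                   [/\ is_tree T',
                       connect (@internal_contraction T') (finest_family T') P
                     & giso T (general_corona P)];
       (* (6) *) exists (T' : sgraph) (P : nbhd_family T'),
                   [/\ is_tree T',
                       connect (@internal_splitting T') (coarsest_family T') P
                     & giso T (general_corona P)]].
Proof.
have nbhd0 (T' : sgraph) (P : nbhd_family T') : is_tree T' ->
    (forall v, #|P v| <= 1) \/ vertex_nbhd_partition P ->
    giso T (general_corona P) -> forall v : T', nbhd v != set0.
  move=> tT' hP /giso_card eT; apply: corona_nbhd_nonempty tT' hP _.
  by rewrite -eT.
tfae.
- move=> [_ sd3]; have [D cD] := sd3_leaf_code T_tree T_order sd3.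
  exists D; split; first by apply/leaf_codeP.
  by move=> D' /leaf_codeP cD'; apply: tree_code_unique T_tree cD cD'.
- move=> [D [/leaf_codeP cD _]].
  by exists (code_label D); apply: leaf_code_family.
- by move=> [l /family_code cD]; apply: leaf_code_corona T_tree cD.
- move=> [T' [P [tT' partP iso]]]; exists T', P; split=> //.
  exact: finest_connect.
- move=> [T' [P [tT' /connect_contraction_partition partP iso]]]; exists T', P; split=> //.
  by apply: coarsest_connect => //; apply: nbhd0 iso; auto.
- move=> [T' [P [tT' conP iso]]].
  have partP : vertex_nbhd_partition P.
    have /connectP[[|Q s] /= ps eP] := conP.
      apply: connect_splitting_partition conP; apply: nbhd0 iso => //.
      by left=> v; rewrite eP ffunE cards1.
    case/andP: ps => /internal_contraction_partition[partQ _] ps.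
    rewrite eP; elim: s Q partQ ps {eP} => //= Q' s IHs Q _.
    by move=> /andP[/internal_contraction_partition[partQ' _] /IHs]; apply.
  have [f bf mf] := iso; apply: code_sd3 => //; last exact: ltnW.
  exact: giso_leaf_code bf mf (corona_code partP).
Qed.
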